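(* For every convex quadrilateral $K\subset\mathbb{R}^2$, the translative covering density and the lattice covering density of $K$ coincide: $\vartheta_T(K)=\vartheta_L(K)$.
   Context: $|S|$ denotes the area of $S$. For a family $\mathcal{F}=\{K_1,K_2,\dots\}$ of convex disks (compact convex subsets of $\mathbb{R}^2$ with nonempty interior) and a bounded domain $D$, let $d_-(\mathcal{F},D)=\frac{1}{|D|}\sum_{K\in\mathcal{F},\,K\subset D}|K|$, and let $d_-(\mathcal{F})=\liminf_{r\to\infty} d_-(\mathcal{F},rB^2)$, where $B^2$ is the unit disk centered at the origin. For a convex disk $K$ and a discrete set $X\subset\mathbb{R}^2$, $K+X$ denotes the family $\{K+x\}_{x\in X}$; it is a translative covering with $K$ if $\bigcup_{x\in X}(K+x)=\mathbb{R}^2$, and a lattice covering if moreover $X$ is a lattice. Define $\vartheta_T(K)=\inf d_-(\mathcal{F})$, the infimum over all translative coverings $\mathcal{F}$ with $K$, and $\vartheta_L(K)=\inf d_-(\mathcal{F})$, the infimum over all lattice coverings $\mathcal{F}$ with $K$. *)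

(* Defs.v *)
From HB Require Import structures.
From mathcomp Require Import all_boot all_order all_algebra.
From mathcomp Require Import all_classical all_reals all_analysis.

Set Implicit Arguments.
Unset Strict Implicit.
Unset Printing Implicit Defensive.

Import Order.TTheory GRing.Theory Num.Theory.
Import numFieldNormedType.Exports.

Local Open Scope classical_set_scope.
Local Open Scope ring_scope.

Section covering_densities.
Variable R : realType.

Definition area (S : set (R * R)) : \bar R :=
  (lebesgue_measure \x lebesgue_measure)%E S.

(* The Euclidean disk: the library norm on R * R is the max norm. *)
Definition disk (r : R) : set (R * R) :=
  [set p | p.1 ^+ 2 + p.2 ^+ 2 <= r ^+ 2].

Definition convex_hull (A : set (R * R)) : set (R * R) :=
  smallest (@convex_set R (R * R)%type) A.

(* Four points in convex position: no vertex lies in the hull of the other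
   three. This excludes coincident or collinear vertices. *)
Definition convex_quadrilateral (K : set (R * R)) : Prop :=
  exists v : 'I_4 -> R * R,
    K = convex_hull (range v) /\
    forall i, ~ convex_hull (v @` [set~ i]) (v i).

Definition translate (K : set (R * R)) (x : R * R) : set (R * R) :=
  [set p + x | p in K].

(* For K nonempty and bounded, x |-> translate K x is injective, so that the
   set of translates is the same as the family indexed by X. *)
Definition translates (K X : set (R * R)) : set (set (R * R)) :=
  [set translate K x | x in X].

Definition discrete_set (X : set (R * R)) : Prop := X `<=` isolated X.

Definition lattice (X : set (R * R)) : Prop :=
  exists u v : R * R,
    (forall s t : R, s *: u + t *: v = 0 -> s = 0 /\ t = 0) /\
    X = [set u *~ m + v *~ n | m in [set: int] & n in [set: int]].

Definition translative_covering (K X : set (R * R)) : Prop :=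
  discrete_set X /\ \bigcup_(x in X) translate K x = setT.

Definition lattice_covering (K X : set (R * R)) : Prop :=
  translative_covering K X /\ lattice X.

Definition inner_density (F : set (set (R * R))) (D : set (R * R)) : \bar R :=
  ((\esum_(K in [set K | F K /\ K `<=` D]) area K) / area D)%E.

Definition lower_density (F : set (set (R * R))) : \bar R :=
  limf_einf (fun r : R => inner_density F (disk r)) (pinfty_nbhs R).

Definition translative_covering_density (K : set (R * R)) : \bar R :=
  ereal_inf [set lower_density (translates K X)
            | X in [set X | translative_covering K X]].

Definition lattice_covering_density (K : set (R * R)) : \bar R :=
  ereal_inf [set lower_density (translates K X)
            | X in [set X | lattice_covering K X]].

End covering_densities.

(* Main.v *)
Require Import Defs.
From HB Require Import structures.
From mathcomp Require Import all_boot all_order all_algebra.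
From mathcomp Require Import all_classical all_reals all_analysis measurable_realfun.
From mathcomp Require Import ring lra.

Set Implicit Arguments.
Unset Strict Implicit.
Unset Printing Implicit Defensive.

Import Order.TTheory GRing.Theory Num.Theory.
Import numFieldNormedType.Exports.

Local Open Scope classical_set_scope.
Local Open Scope ring_scope.

(* A convex quadrilateral has a vertex at which it is, up to an affine map, the
   subgraph of a concave nonincreasing function f on [0, 1]. Let S be the
   largest area of an L-shape (two-corner staircase) inscribed in that subgraph.
   L-shapes tile the plane by translates along a lattice, so lattice coverings
   reach the density |K| / S.
   Conversely, in a finite translative covering, give each point to the
   translate with the highest roof above it, among those whose lower left
   corner lies below and to the left of the point. By concavity, each translate
   owns a subset of an inscribed staircase, and every step of that staircase
   sits at the corner of another translate, which serves in this way for one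
   staircase only. Hence the staircases have at most two corners on average, and
   since the maximal area of a staircase is concave in its number of corners,
   n translates cover an area at most n S. *)

(** * Ownership of points in a finite covering *)

(** Everything rests on one monotonicity: where two translates are both active, the left roof minus
    the right roof is nonincreasing, so a left translate once overtaken by a right one never
    recovers. Moving right at a fixed height, an owner can thus be displaced for two reasons only.
    Either its bottom edge is lost, which happens once per translate and gives one corner charged to
    nobody, or a translate starts between its bottom edge and that height, which gives a corner
    charged to the newcomer. Since only the average number of corners is controlled, the area of a
    staircase must be bounded linearly in that number [n], with value S at [n = 2]. The bound is S1
    + (n - 1)(S - S1), where S1 is the largest area of an inscribed rectangle. The argument for a
    point looks one unit to its right, in normalized coordinates. A disk is therefore charged to
    translates in a disk whose radius is larger by a constant, and this constant disappears in the
    limit. S and S1 are suprema, so the lattice side is an approximation argument. *)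

Section staircase_covering.
Variables (R : realType) (f : R -> R).
Hypothesis f_noninc : forall u v : R, 0 <= u -> u <= v -> v <= 1 -> f v <= f u.
Hypothesis f_concave : forall u v d : R, 0 <= u -> u <= v -> 0 <= d -> v + d <= 1 ->
  f (v + d) + f u <= f (u + d) + f v.
Hypothesis f_left_closed : forall t s y : R, 0 <= t -> t < s -> s <= 1 ->
  (forall r, t <= r -> r < s -> y <= f r) -> y <= f s.

Definition active (x : R * R) (s : R) : bool := (x.1 <= s) && (s <= x.1 + 1).

Definition roof (x : R * R) (s : R) : R := x.2 + f (s - x.1).

(** Ties go to the translate on the right, which by concavity is the one that keeps winning
    afterwards. They also make the owner unique: equal roofs over equal abscissas force equal
    corners. *)
Definition beats (s : R) (x' x : R * R) : bool :=
  (roof x s < roof x' s) || ((roof x s == roof x' s) && (x.1 < x'.1)).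

Lemma beats_trans s x y z : ~~ beats s y x -> ~~ beats s z y -> ~~ beats s z x.
Proof.
rewrite /beats; case: (ltgtP (roof x s) (roof y s)) => //=;
  case: (ltgtP (roof y s) (roof z s)) => //=;
  case: (ltgtP (roof x s) (roof z s)) => //=; lra.
Qed.

Lemma seq_unbeaten s (X : seq (R * R)) : X != [::] ->
  exists2 x, x \in X & forall x', x' \in X -> ~~ beats s x' x.
Proof.
elim: X => // a X IH _; have [->|/IH[m mX mP]] := eqVneq X [::].
  exists a; rewrite ?mem_seq1// => x'; rewrite mem_seq1 => /eqP ->.
  by rewrite /beats ltxx eqxx ltxx.
have [am|am] := boolP (beats s a m).
  exists a; first exact: mem_head.
  move=> x'; rewrite inE => /orP[/eqP ->|/mP x'm].
    by rewrite /beats ltxx eqxx ltxx.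
  apply: (beats_trans _ x'm); move: am; rewrite /beats.
  by case: (ltgtP (roof a s) (roof m s)) => //=; lra.
exists m; first by rewrite inE mX orbT.
by move=> x'; rewrite inE => /orP[/eqP ->//|/mP].
Qed.

Variable X : seq (R * R).

(** Competitors are limited by their bottom edges, not by their roofs: lowering [y] only removes
    some of them. At a covered point the owner does reach [y], since it is unbeaten by a translate
    that does. *)
Definition owns (x : R * R) (s y : R) : Prop :=
  [/\ x \in X, active x s, x.2 <= y &
   forall x', x' \in X -> active x' s -> x'.2 <= y -> ~~ beats s x' x].

Lemma owner_exists s y :
  (exists2 x, x \in X & active x s /\ x.2 <= y) -> exists x, owns x s y.
Proof.
move=> [x0 x0X [ax0 x0y]].
have [|x] := @seq_unbeaten s [seq x <- X | active x s && (x.2 <= y)].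
  rewrite -has_filter; apply/hasP; exists x0 => //; exact/andP.
rewrite mem_filter => /andP[/andP[ax xy] xX] xP; exists x; split => //.
by move=> x' x'X ax' x'y; apply: xP; rewrite mem_filter ax' x'y.
Qed.

Lemma owns_unique x x' s y : owns x s y -> owns x' s y -> x = x'.
Proof.
move=> [xX ax xy xP] [x'X ax' x'y x'P].
have := xP _ x'X ax' x'y; have := x'P _ xX ax xy.
rewrite /beats /roof; case: x x' {xX ax xy xP x'X ax' x'y x'P} => a b [c d] /=.
case: ltgtP => //= E; rewrite -!leNgt => ca ac.
have ac' : a = c by lra.
by subst c; congr pair; lra.
Qed.

(* Beyond [last_abscissa x], the translate with corner [x] loses its bottom
   edge, hence everything, to translates starting below it on its right. *)
Definition alive (x : R * R) (s : R) : Prop :=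
  active x s /\ forall x', x' \in X -> x.1 < x'.1 -> x'.2 <= x.2 ->
    active x' s -> roof x' s < roof x s.

(** The disjunct [s = x.1] keeps the set nonempty when [x] is nowhere alive; the [sup] is then
    [x.1]. *)
Definition last_abscissa (x : R * R) : R := sup [set s | s = x.1 \/ alive x s].

(** Ownership is asked just to the left of the corner of [x'], before [x'] itself competes. Two such
    left neighbourhoods always meet, whence the uniqueness of the parent. *)
Definition child (x x' : R * R) : Prop :=
  [/\ x.1 < x'.1, x'.1 <= x.1 + 1 &
   exists2 u, u < x'.1 & forall s, u <= s -> s < x'.1 -> owns x s x'.2].

Definition children (x : R * R) := [seq x' <- X | `[< child x x' >]].

(** The head is the corner charged to no other translate; the children account for at most one more
    on average. *)
Definition corners (x : R * R) : seq R :=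
  last_abscissa x - x.1 :: [seq x'.1 - x.1 | x' <- children x].

(* Concavity: as [s] grows, the roof of the left translate loses ground. *)
Lemma roof_diff x x' s t : x.1 <= x'.1 -> x'.1 <= s -> s <= t -> t <= x.1 + 1 ->
  roof x t - roof x' t <= roof x s - roof x' s.
Proof.
move=> xx' x's st tx; rewrite /roof.
have := @f_concave (s - x'.1) (t - x'.1) (x'.1 - x.1).
have -> : t - x'.1 + (x'.1 - x.1) = t - x.1 by lra.
have -> : s - x'.1 + (x'.1 - x.1) = s - x.1 by lra.
by move=> /(_ _ _ _ _); lra.
Qed.

Lemma alive_before x s t : x.1 <= s -> s <= t -> alive x t -> alive x s.
Proof.
move=> xs st [/andP[xt tx] al]; split; first by apply/andP; split; lra.
move=> x' x'X xx' x'x /andP[x's sx'].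
have at' : active x' t by apply/andP; split; lra.
have := al _ x'X xx' x'x at'.
by have := @roof_diff x x' s t (ltW xx') x's st tx; lra.
Qed.

Lemma owns_alive x s y : owns x s y -> alive x s.
Proof.
move=> [xX ax xy xP]; split=> // x' x'X xx' x'x ax'.
have /norP[] := xP _ x'X ax' (le_trans x'x xy).
by rewrite -leNgt xx' andbT => + /eqP; lra.
Qed.

Lemma alive_bounded x : has_sup [set s | s = x.1 \/ alive x s].
Proof.
split; first by exists x.1; left.
by exists (x.1 + 1) => s [->|[/andP[_ ]]] //; lra.
Qed.

Lemma last_abscissa_bounds x :
  x.1 <= last_abscissa x /\ last_abscissa x <= x.1 + 1.
Proof.
split; first by apply: ub_le_sup; [exact: (alive_bounded x).2|left].
apply: ge_sup; first by exists x.1; left.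
by move=> s [->|[/andP[_ ]]] //; lra.
Qed.

Lemma alive_lt_last x s : x.1 <= s -> s < last_abscissa x -> alive x s.
Proof.
move=> xs sl; have [t [->|at'] st] := sup_gt (alive_bounded x).1 sl.
  lra.
by apply: alive_before at' => //; exact: ltW.
Qed.

Lemma corners_itv x t : t \in corners x -> 0 <= t /\ t <= 1.
Proof.
rewrite inE => /orP[/eqP ->|/mapP[x' + ->]].
  have [? ?] := last_abscissa_bounds x; split; lra.
by rewrite mem_filter => /andP[/asboolP[? ? _] _]; split; lra.
Qed.

(** A rival at [s] that was active at [t] fails in each position: further left it only loses ground,
    further right and not higher it is excluded because [x] is alive, further right and higher it
    would have won at [t] already, [f] being nonincreasing. A rival that starts after [t] is
    excluded by aliveness if low, and by the last hypothesis if high. *)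
Lemma owns_persists x t y s : owns x t y -> t <= s -> s < last_abscissa x ->
  (forall x', x' \in X -> t < x'.1 -> x.2 < x'.2 -> x'.2 <= y -> s < x'.1) ->
  owns x s y.
Proof.
move=> [xX /andP[xt tx] xy xP] ts sl late.
have [_ l1] := last_abscissa_bounds x.
split=> //; first by apply/andP; split; lra.
move=> x' x'X /andP[x's sx'] x'y; apply/negP => bt.
have [x't|tx'] := leP x'.1 t.
  have ax't : active x' t by apply/andP; split; lra.
  have := xP _ x'X ax't x'y; rewrite /beats negb_or -leNgt => /andP[le_t tie].
  have [x'x|xx'] := leP x'.1 x.1.
    have D := @roof_diff x' x t s x'x xt ts sx'.
    move: bt; rewrite /beats => /orP[|/andP[_]]; lra.
  have lt_t : roof x' t < roof x t.
    by move: tie; rewrite xx' andbT => /eqP; lra.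
  have [x'2|x2] := leP x'.2 x.2.
    have [_ al] : alive x s by apply: alive_lt_last => //; lra.
    have ax's : active x' s by apply/andP.
    have := al _ x'X xx' x'2 ax's.
    by move: bt; rewrite /beats => /orP[|/andP[/eqP]]; lra.
  have : f (t - x.1) <= f (t - x'.1) by apply: f_noninc; lra.
  by move: lt_t; rewrite /roof; lra.
have [x'2|x2] := leP x'.2 x.2.
  have [_ al] : alive x s by apply: alive_lt_last => //; lra.
  have ax's : active x' s by apply/andP.
  have xx' : x.1 < x'.1 by lra.
  have := al _ x'X xx' x'2 ax's.
  by move: bt; rewrite /beats => /orP[|/andP[/eqP]]; lra.
by have := late _ x'X tx' x2 x'y; lra.
Qed.

Lemma owns_below x s y y' : owns x s y -> x.2 <= y' -> y' <= y -> owns x s y'.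
Proof.
move=> [xX ax xy xP] xy' y'y; split => // x' x'X ax' x'y'.
by apply: xP => //; lra.
Qed.

Lemma seq_min (a : R) (s : seq R) :
  exists2 m, m \in a :: s & forall b, b \in a :: s -> m <= b.
Proof.
elim: s => [|b s [m ms mP]].
  by exists a => [|b]; rewrite mem_seq1 // => /eqP ->.
have [bm|mb] := leP b m.
  exists b; first by rewrite !inE eqxx orbT.
  move=> c; rewrite !inE orbCA => /orP[/eqP -> //|cs].
  by apply: (le_trans bm); apply: mP; rewrite inE.
exists m; first by move: ms; rewrite !inE orbCA => ->; rewrite orbT.
move=> c; rewrite !inE orbCA => /orP[/eqP -> //|cs]; first exact: ltW.
by apply: mP; rewrite inE.
Qed.

(** From [p], go right along the horizontal line with the owner of [p], up to the first abscissa [m]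
    where its bottom edge ends or a translate starts between that edge and [p]. The owner is the
    same until [m], so [m] is a corner of its staircase. As [m <= p.1 + 1], coverage of a unit
    segment suffices. *)
Lemma staircase_cover (p : R * R) :
  (forall s, p.1 <= s -> s <= p.1 + 1 ->
    exists2 x, x \in X & [/\ active x s, x.2 <= p.2 & p.2 <= roof x s]) ->
  exists2 x, x \in X & exists2 t, t \in corners x &
    [/\ x.1 <= p.1, p.1 <= x.1 + t, x.2 <= p.2 & p.2 <= x.2 + f t].
Proof.
case: p => t y /= cov.
(* The owner is unbeaten by the translate that covers [(s, y)], so its roof reaches [y] too. *)
have under s x : t <= s -> s <= t + 1 -> owns x s y -> y <= roof x s.
  move=> ts st [xX ax xy xP]; have [x' x'X [ax' x'y yx']] := cov s ts st.
  have := xP _ x'X ax' x'y; rewrite /beats negb_or -leNgt => /andP[+ _]; lra.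
have [x own] : exists x, owns x t y.
  apply: owner_exists; have [|//|x xX [ax xy _]] := cov t; [lra|lra|].
  by exists x.
have [xX /andP[xt tx] xy xP] := own; exists x => //.
have [l0 l1] := last_abscissa_bounds x.
have tl : t <= last_abscissa x.
  by apply: ub_le_sup; [exact: (alive_bounded x).2|right; exact: owns_alive own].
have [tl'|lt'] := ltP t (last_abscissa x); last first.
  have el : last_abscissa x = t by lra.
  exists (t - x.1); first by rewrite inE el eqxx.
  by split=> //; [lra|have := under t x; rewrite /roof; apply => //; lra].
have [m mS mP] := seq_min (last_abscissa x)
  [seq x'.1 | x' <- X & [&& t < x'.1, x.2 < x'.2 & x'.2 <= y]].
have ml : m <= last_abscissa x by apply: mP; rewrite mem_head.
have tm : t < m.
  move: mS; rewrite inE => /orP[/eqP ->//|/mapP[x' + ->]].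
  by rewrite mem_filter => /andP[/and3P[]].
have ownm s : t <= s -> s < m -> owns x s y.
  move=> ts sm; apply: owns_persists own ts _ _; first lra.
  move=> x' x'X tx' xx' x'y; suff : m <= x'.1 by lra.
  apply: mP; rewrite inE; apply/orP; right; apply/mapP; exists x' => //.
  by rewrite mem_filter tx' xx' x'y.
exists (m - x.1).
  move: mS; rewrite inE => /orP[/eqP ->|/mapP[x' + Em]]; first exact: mem_head.
  rewrite mem_filter => /andP[/and3P[tx' xx' x'y] x'X].
  rewrite inE; apply/orP; right; apply/mapP; exists x'; last by rewrite Em.
  rewrite mem_filter x'X andbT; apply/asboolP; split; [lra|lra|].
  exists t => // s ts sx'; apply: owns_below (ltW xx') x'y.
  by apply: ownm => //; rewrite Em.
split=> //; first lra.
suff : y - x.2 <= f (m - x.1) by lra.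
(* At [m] itself the newcomer may already be the owner, so the bound at [m] comes from the left. *)
apply: (@f_left_closed (t - x.1)); [lra|lra|lra|move=> r tr rm].
have := under (r + x.1) x; rewrite /roof addrK => H.
have : y <= x.2 + f r; last lra.
by apply: H; [lra|lra|apply: ownm; lra].
Qed.

Lemma parent_unique x1 x2 x' : child x1 x' -> child x2 x' -> x1 = x2.
Proof.
move=> [_ _ [u1 u1x P1]] [_ _ [u2 u2x P2]].
have mx : Num.max u1 u2 < x'.1 by rewrite gt_max u1x.
by apply: (@owns_unique _ _ (Num.max u1 u2) x'.2);
  [apply: P1|apply: P2]; rewrite // le_max lexx ?orbT.
Qed.

(** Double counting: after exchanging the sums, each [x'] contributes its number of parents, at most
    one. *)
Lemma sum_children : uniq X -> (\sum_(x <- X) size (children x) <= size X)%N.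
Proof.
move=> uX.
under eq_bigr do rewrite size_filter -sum1_count big_mkcond.
rewrite exchange_big /= -sum1_size; apply: leq_sum => x' _.
rewrite -big_mkcond sum1_count.
case E : (has (fun x => `[< child x x' >]) X); last first.
  by move/negbT: E; rewrite has_count -leqNgt => /leq_trans; apply.
have /hasP[x0 x0X /asboolP cx0] := E.
rewrite (@eq_count _ _ (pred1 x0)).
  by rewrite count_uniq_mem// leq_b1.
move=> x /=; apply/asboolP/eqP => [cx|->//]; exact: parent_unique cx cx0.
Qed.

End staircase_covering.

(** * Areas of rectangles and of affine preimages *)

Section area_rectangles.
Variable R : realType.
Local Notation T := (measurableTypeR R).

Lemma area_le (A B : set (T * T)) : measurable A -> measurable B ->
  A `<=` B -> (area A <= area B)%E.
Proof. by move=> mA mB AB; apply: le_measure; rewrite ?inE. Qed.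

Lemma area_setU (A B : set (T * T)) : measurable A -> measurable B ->
  A `&` B = set0 -> area (A `|` B) = (area A + area B)%E.
Proof. by move=> mA mB AB; rewrite /area measureU. Qed.

Definition rect (r : (R * R) * (R * R)) : set (R * R) :=
  `[r.1.1, r.1.2] `*` `[r.2.1, r.2.2].

Lemma measurable_rect r : measurable (rect r).
Proof. exact: measurableX. Qed.

Lemma area_rect r : r.1.1 <= r.1.2 -> r.2.1 <= r.2.2 ->
  area (rect r) = ((r.1.2 - r.1.1) * (r.2.2 - r.2.1))%:E.
Proof.
move=> r1 r2; rewrite /area /rect product_measure1E//= !lebesgue_measure_itv/=.
rewrite !lte_fin EFinM; congr (_ * _)%E; case: ltP => //; rewrite -?EFinB// => H;
  congr EFin; lra.
Qed.

Lemma measurable_rects (rs : seq ((R * R) * (R * R))) :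
  measurable [set p | exists2 r, r \in rs & rect r p].
Proof.
have -> : [set p | exists2 r, r \in rs & rect r p] =
    \big[setU/set0]_(r <- rs) rect r.
  by rewrite -bigcup_seq; apply/seteqP; split=> p [r]; exists r.
by apply: bigsetU_measurable => r _; exact: measurable_rect.
Qed.

Lemma area_rects (rs : seq ((R * R) * (R * R))) (D : set (R * R)) :
  measurable D -> D `<=` [set p | exists2 r, r \in rs & rect r p] ->
  (area D <= \sum_(r <- rs) area (rect r))%E.
Proof.
move=> mD /(area_le mD (measurable_rects rs)) /le_trans; apply.
elim: rs => [|r rs IH].
  rewrite big_nil [X in area X](_ : _ = set0); last by apply/seteqP; split => // p [r].
  by rewrite /area measure0.
rewrite big_cons.
have -> : [set p | exists2 r0, r0 \in r :: rs & rect r0 p] =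
    rect r `|` [set p | exists2 r, r \in rs & rect r p].
  apply/seteqP; split => p.
    by case=> r0; rewrite inE => /orP[/eqP ->|H] ?; [left|right; exists r0].
  case=> [?|[r0 H ?]]; first by exists r; rewrite ?mem_head.
  by exists r0; rewrite // inE H orbT.
apply: le_trans (measureU2 _ _ _) (leeD2l _ IH); [exact: measurable_rect|].
exact: measurable_rects.
Qed.

End area_rectangles.

(** * Scaling of area under affine maps *)

Section affine_area.
Variable R : realType.
Local Notation leb := (@lebesgue_measure R).
Local Notation T := (measurableTypeR R).

Definition line_map (a t : R) : T -> T := fun y => a * y + t.

Lemma measurable_line_map a t : measurable_fun setT (line_map a t).
Proof. exact: measurable_funD. Qed.

HB.instance Definition _ a t :=
  isMeasurableFun.Build _ _ _ _ (line_map a t) (measurable_line_map a t).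

(** By uniqueness of Lebesgue measure, a comparison with the scaled pushforward on half-open
    intervals suffices. For [a < 0] the preimage is closed at the other end, whence two cases. *)
Lemma lebesgue_measure_line_map a t (B : set R) : a != 0 -> measurable B ->
  leb (line_map a t @^-1` B) = (`|a|^-1%:E * leb B)%E.
Proof.
move=> a0 mB.
have na : 0 < `|a| by rewrite normr_gt0.
have an : (`|a|%:E * leb (line_map a t @^-1` B) = leb B)%E.
  apply/esym.
  apply: (@lebesgue_measure_unique _ (mscale `|a|%:nng (pushforward leb (line_map a t)))) => // _ [[p q] _ <-].
  have [a_gt0|a_lt0] : 0 < a \/ a < 0 by move: a0; rewrite neq_lt => /orP[]; auto.
    rewrite [RHS](_ : _ =
        (`|a|%:E * leb `]((p - t) / a)%R, ((q - t) / a)%R]%classic)%E); last first.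
      rewrite -[LHS]/(`|a|%:E * leb (line_map a t @^-1` `]p, q]))%E.
      congr (_ * leb _)%E; apply/seteqP; split => y /=;
        rewrite !in_itv/= /line_map ltr_pdivrMr// ler_pdivlMr//;
        move=> /andP[? ?]; apply/andP; split; lra.
    rewrite !lebesgue_measure_itv/= !lte_fin gtr0_norm// ltr_pM2r ?invr_gt0// ltrD2r.
    case: ifP => _; last by rewrite mule0.
    by rewrite -!EFinB -EFinM; congr EFin; field.
  rewrite [RHS](_ : _ =
      (`|a|%:E * leb `[((q - t) / a)%R, ((p - t) / a)%R[%classic)%E); last first.
    rewrite -[LHS]/(`|a|%:E * leb (line_map a t @^-1` `]p, q]))%E.
    congr (_ * leb _)%E; apply/seteqP; split => y /=;
      rewrite !in_itv/= /line_map ltr_ndivlMr// ler_ndivrMr//;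
      move=> /andP[? ?]; apply/andP; split; lra.
  rewrite !lebesgue_measure_itv/= !lte_fin ltr0_norm// ltr_nM2r ?invr_lt0// ltrD2r.
  case: ifP => _; last by rewrite mule0.
  by rewrite -!EFinB -EFinM; congr EFin; field.
by rewrite -an muleA -EFinM mulVf ?mul1e// gt_eqF.
Qed.

(** Stated through preimages, so that measurability of sets is inherited and factors multiply under
    composition. *)
Definition area_scaling (g : R * R -> R * R) (k : R) : Prop :=
  [/\ measurable_fun (setT : set (T * T)) (g : T * T -> T * T), 0 < k &
    forall S : set (T * T), measurable S -> area (g @^-1` S) = (k%:E * area S)%E].

Lemma area_scaling_comp g h k l :
  area_scaling g k -> area_scaling h l -> area_scaling (g \o h) (l * k).
Proof.
move=> [mg k0 gk] [mh l0 hl]; split; [exact: measurableT_comp mg mh|exact: mulr_gt0|].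
move=> S mS; rewrite comp_preimage hl ?gk ?muleA -?EFinM//.
by rewrite -[X in measurable X]setTI; exact: mg.
Qed.

Lemma area_scaling_swap : area_scaling swap_pair 1.
Proof.
have msw : measurable_fun (setT : set (T * T)) (swap_pair : T * T -> T * T).
  exact: measurable_swap.
split => // S mS; rewrite mul1e.
rewrite /area [RHS](@product_measure_unique _ _ _ _ _ leb leb
  (pushforward (leb \x leb)%E (swap_pair : T * T -> T * T)))//.
move=> A B mA mB.
rewrite -[LHS]/((leb \x leb)%E (swap_pair @^-1` (A `*` B))).
rewrite (_ : _ @^-1` _ = B `*` A); last first.
  by apply/seteqP; split => -[x y] [].
by rewrite product_measure1E// muleC.
Qed.

(** On each vertical line the map is affine of slope [a], and the product measure integrates the
    measures of vertical sections. *)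
Lemma area_scaling_vertical a s t : a != 0 ->
  area_scaling (fun p => (p.1, a * p.2 + (s * p.1 + t))) `|a|^-1.
Proof.
move=> a0; have mg : measurable_fun (setT : set (T * T))
    ((fun p => (p.1, a * p.2 + (s * p.1 + t))) : T * T -> T * T).
  apply/measurable_fun_pairP; split; first exact: measurable_fst.
  apply: measurable_funD; first by apply: measurable_funM => //; exact: measurable_snd.
  by apply: measurable_funD => //; apply: measurable_funM => //; exact: measurable_fst.
split => //; first by rewrite invr_gt0 normr_gt0.
move=> S mS; rewrite /area /product_measure1 -ge0_integralZl//; last first.
  exact: (measurable_fun_xsection leb).
apply: eq_integral => x _ /=.
rewrite -(@lebesgue_measure_line_map a (s * x + t))//.
exact: measurable_xsection.
Qed.

Lemma area_scaling_horizontal a s t : a != 0 ->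
  area_scaling (fun p => (a * p.1 + (s * p.2 + t), p.2)) `|a|^-1.
Proof.
move=> a0; have := area_scaling_comp area_scaling_swap
  (area_scaling_comp (area_scaling_vertical s t a0) area_scaling_swap).
by rewrite mul1r mulr1.
Qed.

Definition affine (A e1 e2 : R * R) (p : R * R) : R * R :=
  A + (p.1 *: e1 + p.2 *: e2).

(** Gaussian elimination with pivot [e1.1], after a swap of the axes if it vanishes: a horizontal
    map followed by a vertical one, whose factor [al] is the determinant divided by the pivot. *)
Lemma area_scaling_affine A e1 e2 :
  e1.1 * e2.2 - e1.2 * e2.1 != 0 -> exists k, area_scaling (affine A e1 e2) k.
Proof.
wlog e10 : e1 e2 / e1.1 != 0.
  move=> H d0; have [e10|] := eqVneq e1.1 0; last by move/H; apply.
  have e20 : e2.1 != 0.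
    by apply: contra_neq d0 => ->; rewrite e10 mulr0 mul0r subrr.
  have -> : affine A e1 e2 = affine A e2 e1 \o swap_pair.
    by apply/funext => p; rewrite /affine/= (addrC (p.1 *: _)).
  have [|k sk] := H e2 e1 e20; first by apply: contra_neq d0 => E; lra.
  by exists (1 * k); exact: area_scaling_comp area_scaling_swap.
move=> d0; pose al := e2.2 - e1.2 * e2.1 / e1.1.
have al0 : al != 0.
  apply: contra_neq d0 => al0; transitivity (e1.1 * al); last by rewrite al0 mulr0.
  by rewrite /al; field.
have V := area_scaling_vertical (e1.2 / e1.1) (A.2 - e1.2 / e1.1 * A.1) al0.
have H := area_scaling_horizontal e2.1 A.1 e10.
have := area_scaling_comp V H; set g := (_ \o _) => sg.
have -> : affine A e1 e2 = g; last by eexists; exact: sg.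
apply/funext => -[u v]; rewrite /g /affine/=; congr pair => /=.
  by rewrite /GRing.scale/=; ring.
by rewrite /GRing.scale /al/=; field.
Qed.

Lemma area_scaling_translation x : area_scaling (fun p => p - x) 1.
Proof.
have := area_scaling_comp (area_scaling_vertical 0 (- x.2) (oner_neq0 R))
  (area_scaling_horizontal 0 (- x.1) (oner_neq0 R)).
set g := (_ \o _) => sg.
have <- : g = (fun p => p - x).
  by apply/funext => p; rewrite /g/= !mul1r !mul0r !add0r [RHS]surjective_pairing.
by move: sg; rewrite !normr1 invr1 mulr1.
Qed.

Lemma translateE (K : set (R * R)) x : translate K x = (fun p => p - x) @^-1` K.
Proof.
apply/seteqP; split => [_ [p Kp <-]|p Kp]; first by rewrite /preimage/= addrK.
by exists (p - x); rewrite ?subrK.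
Qed.

Lemma area_translate (K : set (T * T)) x : measurable K ->
  area (translate K x) = area K.
Proof.
by move=> mK; rewrite translateE; have [_ _ ->] := area_scaling_translation x; rewrite ?mul1e.
Qed.

Lemma measurable_disk r : measurable (disk r : set (T * T)).
Proof.
have mf : measurable_fun (setT : set (T * T)) (fun p => p.1 ^+ 2 + p.2 ^+ 2 : R).
  apply: measurable_funD; apply: measurable_funX.
    exact: measurable_fst.
  exact: measurable_snd.
have := mf measurableT `]-oo, (r ^+ 2)%R]%classic (measurable_itv _).
by rewrite setTI.
Qed.

Lemma area_disk r : 0 < r -> area (disk r) = ((r ^+ 2)%:E * area (disk 1 : set (T * T)))%E.
Proof.
move=> r0; have r1 : r^-1 != 0 by rewrite invr_eq0 gt_eqF.
have [_ _ /(_ _ (measurable_disk 1))] := area_scaling_comp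
  (area_scaling_vertical 0 0 r1) (area_scaling_horizontal 0 0 r1).
rewrite ger0_norm ?invr_ge0 ?ltW// invrK -expr2 => <-; congr area.
apply/seteqP; split => p; rewrite /disk/= !mul0r !addr0 !exprMn -mulrDr exprVn expr1n.
  by rewrite mulrC ler_pdivrMr ?mul1r// exprn_gt0.
by rewrite mulrC ler_pdivrMr ?mul1r// exprn_gt0.
Qed.

End affine_area.

(** * Areas of staircases *)

Section staircase_area.
Variables (R : realType) (f : R -> R).
Hypothesis f_noninc : forall u v : R, 0 <= u -> u <= v -> v <= 1 -> f v <= f u.
Hypothesis f1_ge0 : 0 <= f 1.

Fixpoint stair (a : R) (ts : seq R) : R :=
  if ts is t :: ts' then (t - a) * f t + stair t ts' else 0.

Definition sup_rect : R := sup [set t * f t | t in [set t | 0 <= t /\ t <= 1]].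

Definition Lshapes : set (R * R) := [set t | [/\ 0 <= t.1, t.1 <= t.2 & t.2 <= 1]].

Definition Larea (t : R * R) : R := t.1 * f t.1 + (t.2 - t.1) * f t.2.

Definition sup_Lshape : R := sup [set Larea t | t in Lshapes].

Lemma profile_ge0 t : 0 <= t -> t <= 1 -> 0 <= f t.
Proof. by move=> t0 t1; apply: le_trans f1_ge0 (f_noninc t0 t1 (lexx 1)). Qed.

Lemma Larea_le_sup t : Lshapes t -> Larea t <= sup_Lshape.
Proof.
move=> Lt; apply: ub_le_sup; last by exists t.
exists (f 0 + f 0) => _ [[u v] /= [/= u0 uv v1] <-]; rewrite /Larea /=.
have fu : f u <= f 0 by apply: f_noninc; lra.
have fv : f v <= f 0 by apply: f_noninc; lra.
have fu0 := @profile_ge0 u u0 (le_trans uv v1).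
have fv0 := @profile_ge0 v (le_trans u0 uv) v1.
nra.
Qed.

Lemma rect_le_sup t : 0 <= t -> t <= 1 -> t * f t <= sup_rect.
Proof.
move=> t0 t1; apply: ub_le_sup; last by exists t.
exists (f 0) => _ [u /= [u0 u1] <-].
have fu : f u <= f 0 by apply: f_noninc; lra.
have fu0 := @profile_ge0 u u0 u1; nra.
Qed.

Lemma sup_rect_le a : (forall t, 0 <= t -> t <= 1 -> t * f t <= a) -> sup_rect <= a.
Proof.
move=> H; apply: ge_sup; first by exists (0 * f 0); exists 0 => //=; lra.
by move=> _ [t /= [t0 t1] <-]; exact: H.
Qed.

Lemma sup_rect_le_sup_Lshape : sup_rect <= sup_Lshape.
Proof.
apply: sup_rect_le => t t0 t1.
have := @Larea_le_sup (t, t) (And3 t0 (lexx t) t1).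
by rewrite /Larea /= subrr mul0r addr0.
Qed.

Lemma stair_anti q p ts : q <= p -> path <=%R p ts -> all (fun t => t <= 1) ts ->
  0 <= q -> stair p ts <= stair q ts.
Proof.
case: ts => //= t ts qp /andP[pt _] /andP[t1 _] q0.
have := @profile_ge0 t (le_trans q0 (le_trans qp pt)) t1; nra.
Qed.

(* Trading corners between a staircase and a rectangle: the maximal area of a
   staircase is a concave function of its number of corners. *)
Lemma stair_bound ts : ts != [::] -> path <=%R 0 ts -> all (fun t => t <= 1) ts ->
  stair 0 ts <= sup_rect + (size ts).-1%:R * (sup_Lshape - sup_rect).
Proof.
have [n] := ubnP (size ts); elim: n ts => // n IH [//|p1 [_ _|p2 ts sn _]].
  move=> /= /andP[p0 _] /andP[p1' _]; rewrite subr0 mul0r !addr0.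
  exact: rect_le_sup.
move=> /= /and3P[p10 p12 pts] /and3P[p11 p21 ts1].
(* Regroup staircase and rectangle without loss into an L-shape and a staircase with one corner
   less: [(p1, q)] and [p2 :: ts] if [q] is past [p2], else [(p1, p2)] and [q :: ts]. *)
have step q : 0 <= q -> q <= 1 -> stair 0 [:: p1, p2 & ts] + q * f q <=
    sup_Lshape + (sup_rect + (size ts)%:R * (sup_Lshape - sup_rect)).
  move=> q0 q1 /=; rewrite subr0.
  have [p2q|qp2] := leP p2 q.
    have p2q' : f q <= f p2 by apply: f_noninc; lra.
    have L1 := @Larea_le_sup (p1, q) (And3 p10 (le_trans p12 p2q) q1).
    have := IH (p2 :: ts) sn isT; rewrite /= p21 pts ts1 subr0.
    rewrite (le_trans p10 p12) => /(_ isT isT); move: L1; rewrite /Larea/=.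
    nra.
  have L1 := @Larea_le_sup (p1, p2) (And3 p10 p12 p21).
  have sa := stair_anti (ltW qp2) pts ts1 q0.
  have pq : path <=%R q ts.
    by case: (ts) pts => //= t ts' /andP[p2t ->]; rewrite (le_trans (ltW qp2)).
  have := IH (q :: ts) sn isT; rewrite /= q0 q1 pq ts1 subr0.
  by move=> /(_ isT isT); move: L1; rewrite /Larea/=; lra.
rewrite -[leLHS]/(stair 0 [:: p1, p2 & ts]); move: (stair _ _) step => s step.
(* The supremum over [q] replaces the added rectangle by [sup_rect], which can then be moved to the
   other side. *)
have : sup_rect <=
    sup_Lshape + (sup_rect + (size ts)%:R * (sup_Lshape - sup_rect)) - s.
  by apply: sup_rect_le => q q0 q1; have := step q q0 q1; lra.
rewrite -(addn1 (size ts)) natrD; lra.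
Qed.

Fixpoint steps (x : R * R) (a : R) (ts : seq R) : seq ((R * R) * (R * R)) :=
  if ts is t :: ts' then
    ((x.1 + a, x.1 + t), (x.2, x.2 + f t)) :: steps x t ts'
  else [::].

Lemma area_steps x a ts : 0 <= a -> path <=%R a ts -> all (fun t => t <= 1) ts ->
  (\sum_(r <- steps x a ts) area (rect r) = (stair a ts)%:E)%E.
Proof.
elim: ts a => [|t ts IH] a a0 /=; first by rewrite big_nil.
move=> /andP[at' pts] /andP[t1 ts1]; have t0 := le_trans a0 at'.
have ft := profile_ge0 t0 t1.
rewrite big_cons IH// area_rect/=; [|lra|lra].
by rewrite -EFinD; congr EFin; ring.
Qed.

Lemma in_steps x a ts p t : path <=%R a ts -> t \in ts -> x.1 + a <= p.1 ->
  p.1 <= x.1 + t -> x.2 <= p.2 -> p.2 <= x.2 + f t -> 0 <= a ->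
  all (fun t => t <= 1) ts -> exists2 r, r \in steps x a ts & rect r p.
Proof.
elim: ts a => // t0 ts IH a /= /andP[at0 pts] tts ap pt p2 p2t a0 /andP[t01 ts1].
have [pt0|t0p] := leP p.1 (x.1 + t0).
  exists ((x.1 + a, x.1 + t0), (x.2, x.2 + f t0)); first exact: mem_head.
  split; rewrite /= in_itv/=; apply/andP; split => //.
  apply: (le_trans p2t); rewrite lerD2l.
  move: tts; rewrite inE => /orP[/eqP -> //|tts].
  apply: f_noninc; first lra.
    by have /allP := order_path_min le_trans pts; apply.
  by move/allP: ts1; apply.
have tts' : t \in ts.
  by move: tts; rewrite inE => /orP[/eqP E|//]; move: t0p; rewrite -E ltNge pt.
have [|r rs rp] := IH t0 pts tts' (ltW t0p) pt p2 p2t _ ts1; first lra.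
by exists r => //; rewrite inE rs orbT.
Qed.

Hypothesis f_concave : forall u v d : R, 0 <= u -> u <= v -> 0 <= d -> v + d <= 1 ->
  f (v + d) + f u <= f (u + d) + f v.
Hypothesis f_left_closed : forall t s y : R, 0 <= t -> t < s -> s <= 1 ->
  (forall r, t <= r -> r < s -> y <= f r) -> y <= f s.

Lemma area_covered (X : seq (R * R)) (D : set (R * R)) :
  uniq X -> measurable D ->
  (forall p, D p -> forall s, p.1 <= s -> s <= p.1 + 1 ->
    exists2 x, x \in X & [/\ active x s, x.2 <= p.2 & p.2 <= roof f x s]) ->
  (area D <= ((size X)%:R * sup_Lshape)%:E)%E.
Proof.
move=> uX mD cov.
pose ts x := sort <=%R (corners f X x).
have ts01 x t : t \in ts x -> 0 <= t /\ t <= 1.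
  by rewrite mem_sort; exact: corners_itv.
have pts x : path <=%R 0 (ts x).
  rewrite path_sortedE; last exact: le_trans.
  rewrite sort_sorted ?andbT; last exact: le_total.
  by apply/allP => t /ts01[].
have ts1 x : all (fun t => t <= 1) (ts x) by apply/allP => t /ts01[].
pose rs := flatten [seq steps x 0 (ts x) | x <- X].
have /(area_rects mD) : D `<=` [set p | exists2 r, r \in rs & rect r p].
  move=> p /cov cp.
  have [x xX [t tc [xp pt p2 p2t]]] :=
    staircase_cover f_noninc f_concave f_left_closed cp.
  have [||r rin rp] := @in_steps x 0 (ts x) p t (pts x) _ _ pt p2 p2t (lexx 0) (ts1 x).
  - by rewrite mem_sort.
  - by rewrite addr0.
  by exists r => //; apply/flattenP; exists (steps x 0 (ts x)) => //; exact: map_f.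
move=> /le_trans; apply; rewrite big_flatten/= big_map.
under eq_bigr do rewrite area_steps//.
rewrite sumEFin lee_fin.
pose d := sup_Lshape - sup_rect.
have d0 : 0 <= d by rewrite subr_ge0 sup_rect_le_sup_Lshape.
have : \sum_(x <- X) stair 0 (ts x) <=
    \sum_(x <- X) (sup_rect + (size (children f X x))%:R * d).
  apply: ler_sum => x _.
  have := @stair_bound (ts x) _ (pts x) (ts1 x).
  by rewrite -size_eq0 size_sort/= size_map; apply.
move=> /le_trans; apply.
(* With [n] translates and at most [n] children in all, the total is at most [n * sup_rect + n * d],
   that is, [n * sup_Lshape]. *)
rewrite big_split/= big_const_seq count_predT iter_addr_0 -mulr_suml -natr_sum.
have := sum_children f uX; rewrite -(ler_nat R) => H.
rewrite -mulr_natl; move: d0; rewrite /d; nra.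
Qed.

End staircase_area.

(** * Tilings by L-shapes *)

Section Lshape_tiling.
Variable R : realType.
Variables t1 t2 h1 h2 : R.
Hypotheses (t1_gt0 : 0 < t1) (t12 : t1 <= t2) (h1_gt0 : 0 < h1)
  (h2_ge0 : 0 <= h2) (h21 : h2 <= h1).

(** Half-open, so that the translates partition the plane exactly. *)
Definition Lcell : set (R * R) :=
  `[0, t1[ `*` `[0, h1[ `|` `[t1, t2[ `*` `[0, h2[.

Lemma LcellP q : Lcell q <-> [/\ 0 <= q.1, 0 <= q.2 &
  (q.1 < t1 /\ q.2 < h1) \/ (q.1 < t2 /\ q.2 < h2)].
Proof.
have [T1 T12 H1gt0 H2ge0 H21] := And5 t1_gt0 t12 h1_gt0 h2_ge0 h21.
rewrite /Lcell/= !in_itv/=; split.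
  case=> -[/andP[? ?] /andP[? ?]].
    by split=> //; left.
  by split=> //; [lra|right].
case=> q1 q2; have [qt H|tq H] := ltP q.1 t1.
  by left; rewrite q1 ?qt q2/=; split => //; lra.
by right; rewrite ?tq q2/=; split; lra.
Qed.

Lemma int_cell (a x : R) : 0 < a ->
  exists2 m : int, m%:~R * a <= x & x < (m%:~R + 1) * a.
Proof.
move=> a0; exists (Num.floor (x / a)).
  by rewrite -ler_pdivlMr// ge_floor.
by rewrite -ltr_pdivrMr// -intrD1 floorD1_gt.
Qed.

Lemma int_cell_le (a x : R) (m n : int) : 0 < a ->
  m%:~R * a <= x -> x < (n%:~R + 1) * a -> m <= n.
Proof.
move=> a0 mx xn; have : m%:~R * a < (n%:~R + 1) * a by lra.
by rewrite ltr_pM2r// -intrD1 ltr_int ltzD1.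
Qed.

(** The first generator [(t1, h2)] sets a tile into the notch of the previous one. The second,
    [(t2, h2 - h1)], puts the top left corner of a tile at the top right corner of the low arm.
    Their determinant is, up to sign, the area of the cell. *)
Definition Lvec (m n : int) : R * R :=
  (m%:~R * t1 + n%:~R * t2, m%:~R * h2 + n%:~R * (h2 - h1)).

Definition strip (x : R) : int :=
  xget 0 [set m : int | m%:~R * t1 <= x /\ x < (m%:~R + 1) * t1].

Lemma stripP x : (strip x)%:~R * t1 <= x /\ x < ((strip x)%:~R + 1) * t1.
Proof.
by have [m m1 m2] := int_cell x t1_gt0; rewrite /strip; case: xgetP => [k _ //|/(_ m)[]].
Qed.

(* For fixed [n], the tiles [Lvec m n] meet the vertical line of abscissa [x]
   in the segment between [edge x (n + 1)] and [edge x n]. *)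
Definition edge (x : R) (n : int) : R :=
  (strip (x - n%:~R * t2))%:~R * h2 + h1 + n%:~R * (h2 - h1).

(** As [t1 <= t2], a shift by [t2] loses at least one strip, hence a height [h2], in addition to
    [h1 - h2]. *)
Lemma edge_decr x (n n' : int) : n <= n' ->
  edge x n' <= edge x n - (n' - n)%:~R * h1.
Proof.
have [T1 T12 H1gt0 H2ge0 H21] := And5 t1_gt0 t12 h1_gt0 h2_ge0 h21.
move=> nn'; have [_ k1] := stripP (x - n%:~R * t2).
have [k2 _] := stripP (x - n'%:~R * t2).
have D : 0 <= (n' - n)%:~R :> R by rewrite ler0z subr_ge0.
have : strip (x - n'%:~R * t2) + (n' - n) <= strip (x - n%:~R * t2).
  apply: (@int_cell_le t1 (x - n%:~R * t2)) => //.
  rewrite intrD; rewrite intrB in D *; nra.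
rewrite -(ler_int R) intrD intrB /edge; rewrite intrB in D; nra.
Qed.

Lemma edge_below x y : exists n : int, edge x n <= y.
Proof.
have [T1 T12 H1gt0 H2ge0 H21] := And5 t1_gt0 t12 h1_gt0 h2_ge0 h21.
have [m _ m2] := int_cell (edge x 0 - y) h1_gt0.
have [m0|m0] := leP 0 m.
  exists (m + 1); have := @edge_decr x 0 (m + 1).
  by rewrite addr_ge0// subr0 intrD => /(_ isT); lra.
exists 0; have : m%:~R + 1 <= 0 :> R by rewrite -intrD1 lerz0 lezD1.
nra.
Qed.

Lemma edge_above x y : exists n : int, y < edge x n.
Proof.
have [T1 T12 H1gt0 H2ge0 H21] := And5 t1_gt0 t12 h1_gt0 h2_ge0 h21.
have [m _ m2] := int_cell (y - edge x 0) h1_gt0.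
have [m0|m0] := leP 0 m.
  exists (- (m + 1)); have := @edge_decr x (- (m + 1)) 0.
  by rewrite oppr_le0 addr_ge0// sub0r opprK intrD => /(_ isT); lra.
exists 0; have : m%:~R + 1 <= 0 :> R by rewrite -intrD1 lerz0 lezD1.
nra.
Qed.

Lemma edge_between x y : exists n : int, edge x (n + 1) <= y /\ y < edge x n.
Proof.
have [T1 T12 H1gt0 H2ge0 H21] := And5 t1_gt0 t12 h1_gt0 h2_ge0 h21.
have [a ya] := edge_above x y; have [b yb] := edge_below x y.
have ex : exists j : nat, edge x (a + j%:Z) <= y.
  have [ab|ba] := leP a b.
    by exists `|b - a|%N; rewrite gez0_abs ?subr_ge0// [a + _]addrC subrK.
  exists 0%N; rewrite addr0; have := edge_decr x (ltW ba).
  have : 0 <= (a - b)%:~R :> R by rewrite ler0z subr_ge0 ltW.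
  nra.
case: (ex_minnP ex) => -[|j] Pj minj; first by move: Pj; rewrite addr0; lra.
exists (a + j%:Z); split; first by rewrite -addrA -PoszD addn1.
by rewrite ltNge; apply/negP => /minj; rewrite ltnn.
Qed.

Lemma Lcell_edge (p : R * R) m n : Lcell (p - Lvec m n) ->
  edge p.1 (n + 1) <= p.2 /\ p.2 < edge p.1 n.
Proof.
have [T1 T12 H1gt0 H2ge0 H21] := And5 t1_gt0 t12 h1_gt0 h2_ge0 h21.
case: p => x y /LcellP/= [q1 q2 H]; rewrite /edge.
have [k1 k2] := stripP (x - n%:~R * t2).
have [l1 l2] := stripP (x - (n + 1)%:~R * t2).
have mk : m <= strip (x - n%:~R * t2).
  by apply: (@int_cell_le t1 (x - n%:~R * t2)) => //; lra.
have lm : strip (x - (n + 1)%:~R * t2) + 1 <= m.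
  apply: (@int_cell_le t1 (x - n%:~R * t2 - t2 + t1)) => //.
    by move: l1; rewrite !intrD; lra.
  by case: H => -[]; lra.
move: (strip (x - (n + 1)%:~R * t2)) (strip _) k1 k2 l1 l2 mk lm => l k.
rewrite -!(ler_int R) !intrD => k1 k2 l1 l2 mk lm.
split; first nra.
case: H => -[H1 H2]; last nra.
have : k <= m by apply: (@int_cell_le t1 (x - n%:~R * t2)) => //; lra.
by rewrite -(ler_int R) => ?; nra.
Qed.

(** The edges separate different [n]. For equal [n], the abscissa determines [m] if the point is in
    the tall column, and the ordinate does if it is in the low arm. *)
Lemma Lcell_disjoint (p : R * R) m n m' n' :
  Lcell (p - Lvec m n) -> Lcell (p - Lvec m' n') -> m = m' /\ n = n'.
Proof.
have [T1 T12 H1gt0 H2ge0 H21] := And5 t1_gt0 t12 h1_gt0 h2_ge0 h21.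
wlog nn' : m n m' n' / n <= n'.
  move=> H L L'; have [|/ltW] := leP n n'; first by move/H; apply.
  by move=> /H /(_ L' L) [-> ->].
move=> L L'; have [e1 e2] := Lcell_edge L; have [e1' e2'] := Lcell_edge L'.
have En : n = n'.
  apply/eqP; rewrite eq_le nn'/= leNgt; apply/negP; rewrite -lezD1 => n1.
  have := edge_decr p.1 n1.
  have : 0 <= (n' - (n + 1))%:~R :> R by rewrite ler0z subr_ge0.
  nra.
split => //; move: L L' {e1 e2 e1' e2'}; rewrite -En {nn' En n'}.
wlog mm' : m m' / m <= m'.
  move=> H L L'; have [|/ltW] := leP m m'; first by move/H; apply.
  by move=> /H /(_ L' L).
case: p => x y /LcellP/= [q1 q2 H] /LcellP/= [q1' q2' H'].
apply/eqP; rewrite eq_le mm'/=; case: H => -[H1 H2].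
  by apply: (@int_cell_le t1 (x - n%:~R * t2)) => //; lra.
by apply: (@int_cell_le h2 (y - n%:~R * (h2 - h1))); lra.
Qed.

Lemma Lcell_cover (p : R * R) : exists m n, Lcell (p - Lvec m n).
Proof.
have [T1 T12 H1gt0 H2ge0 H21] := And5 t1_gt0 t12 h1_gt0 h2_ge0 h21.
case: p => x y; have [n []] := edge_between x y; rewrite /edge.
have [k1 k2] := stripP (x - n%:~R * t2).
have [l1 l2] := stripP (x - (n + 1)%:~R * t2).
move: (strip (x - (n + 1)%:~R * t2)) (strip _) k1 k2 l1 l2 => l k k1 k2 l1 l2 e1 e2.
(* Either the point is in the tall column of tile [k], or it is below that tile, where low arms of
   earlier tiles are stacked with period [h2]. *)
have [yk|ky] := leP (k%:~R * h2) (y - n%:~R * (h2 - h1)).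
  exists k, n; apply/LcellP; split => /=; [lra|lra|left; split; lra].
move: l1 l2 e1; rewrite !intrD => l1 l2 e1.
have h2_gt0 : 0 < h2.
  rewrite lt_neqAle h2_ge0 andbT; apply/eqP => h20; move: e1 ky; rewrite -h20; lra.
have [m m1 m2] := int_cell (y - n%:~R * (h2 - h1)) h2_gt0.
have mk : m <= k - 1.
  apply: (@int_cell_le h2 (y - n%:~R * (h2 - h1))) => //; rewrite intrB; lra.
have lm : l + 1 <= m.
  by apply: (@int_cell_le h2 (y - n%:~R * (h2 - h1))) => //; rewrite intrD; lra.
move: mk lm; rewrite -!(ler_int R) intrB intrD => mk lm.
exists m, n; apply/LcellP; split => /=; [nra|nra|right; split; nra].
Qed.

End Lshape_tiling.

(** * Normal form of quadrilaterals *)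

Section profile.
Variable R : realType.

(** Concavity is put as decrease of increments, which compares two shifted roofs directly. The third
    condition is upper semicontinuity from the left, as used at the right end of a step. *)
Definition concave_profile (f : R -> R) : Prop :=
  [/\ forall u v : R, 0 <= u -> u <= v -> v <= 1 -> f v <= f u,
      forall u v d : R, 0 <= u -> u <= v -> 0 <= d -> v + d <= 1 ->
        f (v + d) + f u <= f (u + d) + f v,
      forall t s y : R, 0 <= t -> t < s -> s <= 1 ->
        (forall r, t <= r -> r < s -> y <= f r) -> y <= f s
    & 0 <= f 1].

Definition region (f : R -> R) : set (R * R) :=
  [set p | [/\ 0 <= p.1, p.1 <= 1, 0 <= p.2 & p.2 <= f p.1]].

Lemma affine_left_closed (a b t s y : R) : t < s ->
  (forall r, t <= r -> r < s -> y <= a - b * r) -> y <= a - b * s.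
Proof.
move=> ts H; rewrite leNgt; apply/negP => lt_y.
have [b0|b0] := leP b 0; first by have := H t (lexx t) ts; nra.
(* Going back by [e] from [s] makes up only half of the gap between the affine function and [y]. *)
pose e := (y - (a - b * s)) / b / 2.
have e0 : 0 < e by rewrite /e; apply: divr_gt0 => //; apply: divr_gt0; lra.
have Ee : b * e = (y - (a - b * s)) / 2.
  by rewrite /e; field; rewrite gt_eqF.
have [st|st] := leP t (s - e).
  by have := H _ st; rewrite gtrBl => /(_ e0); nra.
have := H t (lexx t) ts; nra.
Qed.

Lemma concave_profile_min (a1 b1 a2 b2 : R) : 0 <= b1 -> 0 <= b2 ->
  0 <= Num.min (a1 - b1) (a2 - b2) ->
  concave_profile (fun u => Num.min (a1 - b1 * u) (a2 - b2 * u)).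
Proof.
move=> b10 b20 H1; split.
- move=> u v u0 uv v1; rewrite le_min !ge_min; apply/andP; split; apply/orP.
    by left; nra.
  by right; nra.
- move=> u v d u0 uv d0 vd1.
  pose f r := Num.min (a1 - b1 * r) (a2 - b2 * r).
  change (f (v + d) + f u <= f (u + d) + f v).
  have fl i r : f r <= (if i then a1 - b1 * r else a2 - b2 * r).
    by rewrite /f ge_min; case: i; rewrite lexx ?orbT.
  have fmin c w r : 0 < w -> (forall i, c <= w * (if i then a1 - b1 * r else a2 - b2 * r)) ->
      c / w <= f r.
    move=> w0 H; rewrite ler_pdivrMr// mulrC /f.
    by case: (leP (a1 - b1 * r) _) => _; [exact: (H true)|exact: (H false)].
  have [w0|w0] := leP (v + d) u.
    have [-> ->] : d = 0 /\ v = u by split; lra.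
    by rewrite addr0.
  have w1 : 0 < v + d - u by lra.
  have F i : f u <= (if i then a1 - b1 * u else a2 - b2 * u) by exact: fl.
  have G i : f (v + d) <= (if i then a1 - b1 * (v + d) else a2 - b2 * (v + d)) by exact: fl.
  (* [u + d] and [v] divide the segment from [u] to [v + d] in opposite ratios, so the two chord
     bounds add up to the sum of the end values. *)
  have := @fmin ((v - u) * f u + d * f (v + d)) (v + d - u) (u + d) w1.
  have := @fmin (d * f u + (v - u) * f (v + d)) (v + d - u) v w1.
  move=> A1 A2.
  have B1 := A1 _; have B2 := A2 _.
  apply: le_trans (lerD (B2 _) (B1 _)).
  - have -> : ((v - u) * f u + d * f (v + d)) / (v + d - u) +
        (d * f u + (v - u) * f (v + d)) / (v + d - u) = f (v + d) + f u.
      by field; lra.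
    exact: lexx.
  - by move=> i; have := F i; have := G i; case: i; nra.
  - by move=> i; have := F i; have := G i; case: i; nra.
- move=> t s y t0 ts s1 H; rewrite le_min; apply/andP; split.
    by apply: (affine_left_closed ts) => r tr rs; have := H r tr rs; rewrite le_min => /andP[].
  by apply: (affine_left_closed ts) => r tr rs; have := H r tr rs; rewrite le_min => /andP[].
- by rewrite !mulr1.
Qed.

Lemma measurable_region (f : R -> R) :
  measurable_fun setT (f : measurableTypeR R -> measurableTypeR R) ->
  measurable (region f : set (measurableTypeR R * measurableTypeR R)).
Proof.
move=> mf.
have mh : measurable_fun (setT : set (measurableTypeR R * measurableTypeR R))
    (fun p => f p.1 - p.2 : R).
  apply: measurable_funB; last exact: measurable_snd.
  exact: measurableT_comp mf measurable_fst.
have -> : region f = `[0, 1] `*` `[0, +oo[ `&` (fun p => f p.1 - p.2) @^-1` `[0, +oo[.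
  apply/seteqP; split => p; rewrite /region/= !in_itv/= !andbT subr_ge0.
    by case=> -> -> -> ->.
  by case=> -[/andP[]].
apply: measurableI; first exact: measurableX.
rewrite -[X in measurable X]setTI; exact: mh.
Qed.

End profile.

(** * Convex hulls of four points and their affine normal form *)

Section quadrilateral.
Variable R : realType.
Implicit Types (C H : set (R * R)) (p q r s x y : R * R).

Definition mix (t : R) x y : R * R :=
  (t * x.1 + (1 - t) * y.1, t * x.2 + (1 - t) * y.2).

Definition mix_closed C : Prop :=
  forall t x y, 0 <= t -> t <= 1 -> C x -> C y -> C (mix t x y).

Lemma mix_closedP C : @convex_set R (R * R)%type C <-> mix_closed C.
Proof.
split=> [cC t x y t0 t1 Cx Cy|mC x y k].
  by have /set_mem := cC x y (Itv01 t0 t1) (mem_set Cx) (mem_set Cy).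
move=> /set_mem Cx /set_mem Cy; apply/mem_set.
by apply: (mC k%:num).
Qed.

Lemma mix_closed_hull (A : set (R * R)) : mix_closed (convex_hull A).
Proof.
move=> t x y t0 t1 Hx Hy C [cC AC].
have /mix_closedP := cC; apply=> //; first exact: (Hx C).
exact: (Hy C).
Qed.

Definition triangle p q r : set (R * R) :=
  [set x | exists a b c, [/\ 0 <= a, 0 <= b, 0 <= c, a + b + c = 1 &
    x = (a * p.1 + b * q.1 + c * r.1, a * p.2 + b * q.2 + c * r.2)]].

Lemma triangle_sub C p q r : mix_closed C -> C p -> C q -> C r ->
  triangle p q r `<=` C.
Proof.
move=> mC Cp Cq Cr _ [a [b [c [a0 b0 c0 s1 ->]]]].
have [c1|c1] := eqVneq c 1.
  have -> : a = 0 by lra.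
  have -> : b = 0 by lra.
  by rewrite c1 !mul0r !add0r !mul1r; case: (r) Cr.
have c_lt1 : 0 < 1 - c by rewrite subr_gt0 lt_neqAle c1; lra.
have := mC c r (mix (a / (1 - c)) p q) c0 _ Cr _.
have -> : mix c r (mix (a / (1 - c)) p q) =
    (a * p.1 + b * q.1 + c * r.1, a * p.2 + b * q.2 + c * r.2).
  have -> : b = 1 - a - c by lra.
  by rewrite /mix/=; congr pair; field; lra.
apply; first lra.
apply: mC => //; first by apply: divr_ge0 => //; lra.
by rewrite ler_pdivrMr//; lra.
Qed.

Definition orient p q r : R :=
  (q.1 - p.1) * (r.2 - p.2) - (q.2 - p.2) * (r.1 - p.1).

Lemma between_triangle p q r s t : 0 <= t -> t <= 1 -> p = mix t q r ->
  triangle q r s p.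
Proof.
move=> t0 t1 ->; exists t, (1 - t), 0; split=> //; [lra|lra|].
by rewrite /mix; congr pair; lra.
Qed.

Lemma collinear_between p q r : orient p q r = 0 ->
  exists2 t, 0 <= t /\ t <= 1 & [\/ p = mix t q r, q = mix t p r | r = mix t p q].
Proof.
move=> o0; have [->|pq] := eqVneq p q.
  exists 1; [lra|apply: Or31].
  by rewrite /mix; case: (q) => ? ?; congr pair => /=; lra.
(* [k] is the position of [r] on the line where [p] is at 0 and [q] at 1; its range tells which
   point is in the middle. *)
have [k kE] : exists k, r = (p.1 + k * (q.1 - p.1), p.2 + k * (q.2 - p.2)).
  have [e1|n1] := eqVneq q.1 p.1.
    have n2 : q.2 - p.2 != 0.
      apply: contra_neq pq => e2.
      by case: p q e1 e2 {o0} => ? ? [? ?] /= -> ?; congr pair; lra.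
    exists ((r.2 - p.2) / (q.2 - p.2)); rewrite divfK//.
    case: r o0 => r1 r2 /=; rewrite /orient/= e1 => o0; congr pair; last lra.
    have : (q.2 - p.2) * (r1 - p.1) = 0 by lra.
    by move/eqP; rewrite mulf_eq0 (negPf n2)/= => /eqP; lra.
  have n1' : q.1 - p.1 != 0 by rewrite subr_eq0.
  exists ((r.1 - p.1) / (q.1 - p.1)); rewrite divfK//.
  case: r o0 => r1 r2 /=; rewrite /orient/= => o0; congr pair; first lra.
  have -> : (r1 - p.1) / (q.1 - p.1) * (q.2 - p.2) = r2 - p.2; last lra.
  by rewrite mulrAC; apply: (mulIf n1'); rewrite divfK//; lra.
have [k0|k0] := ltP k 0.
  exists (- k / (1 - k)).
    by rewrite divr_ge0 ?ler_pdivrMr; lra.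
  apply: Or31; rewrite kE /mix/=; case: (p) => ? ?; congr pair => /=; field; lra.
have [k1|k1] := leP k 1.
  exists (1 - k); first lra.
  by apply: Or33; rewrite kE /mix; congr pair; ring.
exists (1 - k^-1).
  have i0 : 0 < k^-1 by rewrite invr_gt0; lra.
  have i1 : k^-1 <= 1 by rewrite invf_le1; lra.
  lra.
by apply: Or32; rewrite kE /mix/=; case: (q) => ? ?; congr pair => /=; field; lra.
Qed.

(** Upper boundary of the quadrilateral with vertices [(0, 0)], [(1, 0)], [(0, 1)], [(a, b)]: the
    lines from [(a, b)] to [(0, 1)] and to [(1, 0)]. For [a = 1] the second is vertical and is
    replaced by the constant 1, which lies above the first. *)
Definition corner_profile (a b u : R) : R :=
  Num.min (1 - (1 - b) / a * u)
    ((if a == 1 then 1 else b / (1 - a)) -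
     (if a == 1 then 0 else b / (1 - a)) * u).

Lemma corner_profileP a b : 0 < a -> a <= 1 -> 0 < b -> b <= 1 -> 1 <= a + b ->
  concave_profile (corner_profile a b).
Proof.
move=> a0 a1 b0 b1 ab; apply: concave_profile_min.
- by apply: divr_ge0; lra.
- by case: eqVneq => // a1'; apply: divr_ge0; lra.
- rewrite le_min; apply/andP; split.
    by rewrite subr_ge0 ler_pdivrMr//; lra.
  by case: eqVneq => _; lra.
Qed.

Definition normal_form H : Prop := exists A e1 e2 f,
  [/\ e1.1 * e2.2 - e1.2 * e2.1 != 0, concave_profile f,
      measurable (region f : set (measurableTypeR R * measurableTypeR R)),
      exists u, [/\ 0 < u, u <= 1 & 0 < f u] &
      H = affine A e1 e2 @` region f].

Lemma affine_mix A e1 e2 t x y :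
  affine A e1 e2 (mix t x y) = mix t (affine A e1 e2 x) (affine A e1 e2 y).
Proof. by rewrite /affine /mix/=; congr pair => /=; rewrite /GRing.scale/=; ring. Qed.

Lemma region_mix_closed a b : mix_closed (region (corner_profile a b)).
Proof.
move=> t [u w] [u' w'] t0 t1 [/= u0 u1 w0 wf] [/= u0' u1' w0' wf'].
split=> /=; [nra|nra|nra|].
move: wf wf'; rewrite /corner_profile !le_min.
move: ((1 - b) / a) (if _ then _ else _) (if _ then _ else _) => c d e.
move=> /andP[A1 A2] /andP[B1 B2]; apply/andP; split; nra.
Qed.

Lemma region_sub a b C : 0 < a -> a <= 1 -> 0 < b -> b <= 1 -> 1 <= a + b ->
  mix_closed C -> C (0, 0) -> C (1, 0) -> C (0, 1) -> C (a, b) ->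
  region (corner_profile a b) `<=` C.
Proof.
move=> a0 a1 b0 b1 ab mC C0 CX CY CZ [u w] [/= u0 u1 w0].
rewrite /corner_profile le_min => /andP[w1 w2].
have Cu : C (u, 0).
  have -> : (u, 0) = mix u (1, 0) (0, 0) by rewrite /mix/=; congr pair; ring.
  exact: mC.
have vert h : C (u, h) -> w <= h -> C (u, w).
  move=> Ch wh; have [h0|h0] := leP h 0.
    by have -> : w = 0 by lra.
  have -> : (u, w) = mix (w / h) (u, h) (u, 0).
    by rewrite /mix/=; congr pair; field; lra.
  apply: mC => //; first by apply: divr_ge0; lra.
  by rewrite ler_pdivrMr//; lra.
have [ua|au] := leP u a.
  apply: vert w1.
  have -> : (u, 1 - (1 - b) / a * u) = mix (u / a) (a, b) (0, 1).
    by rewrite /mix/=; congr pair; field; lra.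
  apply: mC => //; first by apply: divr_ge0; lra.
  by rewrite ler_pdivrMr//; lra.
move: w2; case: eqVneq => [|na w2]; first lra.
apply: vert w2.
have -> : (u, b / (1 - a) - b / (1 - a) * u) = mix ((1 - u) / (1 - a)) (a, b) (1, 0).
  by rewrite /mix/=; congr pair; field; lra.
apply: mC => //; first by apply: divr_ge0; lra.
by rewrite ler_pdivrMr//; lra.
Qed.

Lemma region_vertices a b : 0 < a -> a <= 1 -> 0 < b -> b <= 1 -> 1 <= a + b ->
  [/\ region (corner_profile a b) (0, 0), region (corner_profile a b) (1, 0),
      region (corner_profile a b) (0, 1) & region (corner_profile a b) (a, b)].
Proof.
move=> a0 a1 b0 b1 ab.
have [f_noninc _ _ f1] := corner_profileP a0 a1 b0 b1 ab.
have f0 : 1 <= corner_profile a b 0.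
  rewrite /corner_profile !mulr0 !subr0 le_min lexx/=; case: eqVneq => // na.
  by rewrite ler_pdivlMr; lra.
have fa : b <= corner_profile a b a.
  rewrite /corner_profile le_min; apply/andP; split.
    by rewrite divfK; lra.
  case: eqVneq => [_|na]; first lra.
  have -> : b / (1 - a) - b / (1 - a) * a = b by field; lra.
  exact: lexx.
by split; split=> /=; lra.
Qed.

(** In the affine frame at [p] with arms to [q] and [r], the point [s] has coordinates [(a, b)]. The
    bounds on [a] and [b] are what makes the upper boundary nonincreasing and concave. *)
Lemma quadrilateral_corner H p q r s a b :
  mix_closed H -> H p -> H q -> H r -> H s ->
  (forall C, mix_closed C -> C p -> C q -> C r -> C s -> H `<=` C) ->
  orient p q r != 0 -> 0 < a -> a <= 1 -> 0 < b -> b <= 1 -> 1 <= a + b ->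
  s = ((1 - a - b) * p.1 + a * q.1 + b * r.1, (1 - a - b) * p.2 + a * q.2 + b * r.2) ->
  normal_form H.
Proof.
move=> mH Hp Hq Hr Hs minH o0 a0 a1 b0 b1 ab sE.
have [V0 VX VY VZ] := region_vertices a0 a1 b0 b1 ab.
pose g := affine p (q - p) (r - p).
have g0 : g (0, 0) = p by rewrite /g /affine/= !scale0r !addr0.
have gX : g (1, 0) = q by rewrite /g /affine/= scale0r scale1r addr0 addrC subrK.
have gY : g (0, 1) = r by rewrite /g /affine/= scale0r scale1r add0r addrC subrK.
have gZ : g (a, b) = s.
  by rewrite /g /affine sE/=; congr pair => /=; rewrite /GRing.scale/=; ring.
exists p, (q - p), (r - p), (corner_profile a b); split => //.
- exact: corner_profileP.
- by apply: measurable_region; apply: measurable_minr; exact: measurable_funB.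
- by exists a; split=> //; case: VZ => /= _ _ _; lra.
apply/seteqP; split.
  apply: minH.
  - move=> t _ _ t0 t1 [x Kx <-] [y Ky <-]; exists (mix t x y).
      exact: region_mix_closed.
    exact: affine_mix.
  - by exists (0, 0).
  - by exists (1, 0).
  - by exists (0, 1).
  - by exists (a, b).
move=> _ [x Kx <-]; move: x Kx.
have mgH : mix_closed (g @^-1` H).
  by move=> t x y t0 t1 Hx Hy; rewrite /preimage/= /g affine_mix; exact: mH.
by apply: (@region_sub a b (g @^-1` H)) => //; rewrite /preimage/= ?g0 ?gX ?gY ?gZ.
Qed.

Lemma triangleC12 p q r : triangle p q r `<=` triangle q p r.
Proof.
move=> x [a [b [c [a0 b0 c0 s1 ->]]]]; exists b, a, c; split=> //; first lra.
by congr pair; lra.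
Qed.

Lemma triangleC23 p q r : triangle p q r `<=` triangle p r q.
Proof.
move=> x [a [b [c [a0 b0 c0 s1 ->]]]]; exists a, c, b; split=> //; first lra.
by congr pair; lra.
Qed.

Lemma norm_orientC12 p q r : `|orient q p r| = `|orient p q r|.
Proof. by rewrite -normrN; congr `|_|; rewrite /orient; ring. Qed.

Lemma norm_orientC23 p q r : `|orient p r q| = `|orient p q r|.
Proof. by rewrite -normrN; congr `|_|; rewrite /orient; ring. Qed.

Definition outside p q r s : Prop := [/\ ~ triangle q r s p, ~ triangle p r s q,
  ~ triangle p q s r & ~ triangle p q r s].

Lemma outside_orient p q r s : outside p q r s -> orient p q r != 0.
Proof.
move=> [np nq nr _]; apply/eqP => /collinear_between[t [t0 t1] [E|E|E]].
- exact/np/(between_triangle _ t0 t1).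
- exact/nq/(between_triangle _ t0 t1).
- exact/nr/(between_triangle _ t0 t1).
Qed.

(* The weights of the affine dependency of four points are, up to sign, the
   areas of the triangles they span; the vertex of largest weight is opposite
   to the corner used in the normal form. *)
Lemma largest_triangle_normal_form H p q r s :
  mix_closed H -> H p -> H q -> H r -> H s ->
  (forall C, mix_closed C -> C p -> C q -> C r -> C s -> H `<=` C) ->
  outside p q r s ->
  `|orient s q r| <= `|orient p q r| -> `|orient p s r| <= `|orient p q r| ->
  `|orient p q s| <= `|orient p q r| -> normal_form H.
Proof.
move=> mH Hp Hq Hr Hs minH out; have o0 := outside_orient out.
have [_ _ _ ns] := out.
have no : 0 < `|orient p q r| by rewrite normr_gt0.
have le1 k : `|k| <= `|orient p q r| -> - 1 <= k / orient p q r <= 1.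
  by move=> ?; rewrite -ler_norml normrM normfV ler_pdivrMr// mul1r.
move=> /le1/andP[A0 A1] /le1/andP[B0 B1] /le1/andP[C0 C1].
set al := _ / _ in A0 A1; set be := _ / _ in B0 B1; set ga := _ / _ in C0 C1.
have sum1 : al + be + ga = 1.
  by rewrite /al /be /ga; move: o0; rewrite /orient => o0; field.
have sE : s = (al * p.1 + be * q.1 + ga * r.1, al * p.2 + be * q.2 + ga * r.2).
  rewrite [LHS]surjective_pairing; congr pair; rewrite /al /be /ga;
    by move: o0; rewrite /orient => o0; field.
have minH' p' q' r' : (forall C, C p' -> C q' -> C r' -> [/\ C p, C q & C r]) ->
    forall C, mix_closed C -> C p' -> C q' -> C r' -> C s -> H `<=` C.
  by move=> perm C mC Cp Cq Cr Cs; have [? ? ?] := perm C Cp Cq Cr; exact: minH.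
(* If one weight is negative, the other two add up to more than 1 while neither exceeds 1, so both
   are positive; the vertex of negative weight is the corner. *)
have [a_neg|a_pos] := ltP al 0.
  apply: (@quadrilateral_corner H p q r s be ga) => //; [lra|lra|lra|].
  by rewrite [LHS]sE (_ : 1 - be - ga = al)//; lra.
have [b_neg|b_pos] := ltP be 0.
  apply: (@quadrilateral_corner H q p r s al ga) => //; 
    [|by rewrite -normr_gt0 norm_orientC12 normr_gt0|lra|lra|lra|].
    by apply: minH' => C *; split.
  by rewrite [LHS]sE (_ : 1 - al - ga = be); [congr pair; ring|lra].
have [c_neg|c_pos] := ltP ga 0.
  apply: (@quadrilateral_corner H r q p s be al) => //; 
    [|by rewrite -normr_gt0 norm_orientC12 norm_orientC23 norm_orientC12 normr_gt0
    |lra|lra|lra|].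
    by apply: minH' => C *; split.
  by rewrite [LHS]sE (_ : 1 - be - al = ga); [congr pair; ring|lra].
by exfalso; apply: ns; exists al, be, ga; split.
Qed.

Lemma outsideC12 p q r s : outside p q r s -> outside q p r s.
Proof.
by move=> [np nq nr ns]; split=> // T; [apply: nr|apply: ns]; exact: triangleC12.
Qed.

Lemma outsideC23 p q r s : outside p q r s -> outside p r q s.
Proof.
move=> [np nq nr ns]; split=> // T; first exact/np/triangleC12.
exact/ns/triangleC23.
Qed.

Lemma outsideC34 p q r s : outside p q r s -> outside p q s r.
Proof.
by move=> [np nq nr ns]; split=> // T; [apply: np|apply: nq]; exact: triangleC23.
Qed.

Lemma quadrilateral_normal_form_points H p q r s :
  mix_closed H -> H p -> H q -> H r -> H s ->
  (forall C, mix_closed C -> C p -> C q -> C r -> C s -> H `<=` C) ->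
  outside p q r s -> normal_form H.
Proof.
move=> mH Hp Hq Hr Hs minH out.
have E1 := norm_orientC12; have E2 := norm_orientC23.
have C34 := outsideC34 out.
have C324 := outsideC34 (outsideC23 out).
have C234 := outsideC34 (outsideC23 (outsideC12 out)).
have e1 : `|orient s q r| = `|orient q r s| by rewrite E1 E2.
have e2 : `|orient p s r| = `|orient p r s| by rewrite E2.
have e3 : `|orient r q s| = `|orient q r s| by rewrite E1.
have e4 : `|orient p r q| = `|orient p q r| by rewrite E2.
have e5 : `|orient q p s| = `|orient p q s| by rewrite E1.
have e6 : `|orient q r p| = `|orient p q r| by rewrite E2 E1.
have Ls := @largest_triangle_normal_form H p q r s mH Hp Hq Hr Hs minH out.
have Lr := @largest_triangle_normal_form H p q s r mH Hp Hq Hs Hr _ C34.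
have Lq := @largest_triangle_normal_form H p r s q mH Hp Hr Hs Hq _ C324.
have Lp := @largest_triangle_normal_form H q r s p mH Hq Hr Hs Hp _ C234.
rewrite e1 e2 in Ls; rewrite e3 in Lr; rewrite e4 in Lq; rewrite e5 e6 in Lp.
move: {e1 e2 e3 e4 e5 e6} (`|orient p q r|) (`|orient p q s|) (`|orient p r s|)
  (`|orient q r s|) Ls Lr Lq Lp => ds dr dq dp Ls Lr Lq Lp.
have [sr|rs] := leP dr ds;
  have [sq|qs] := leP dq dp.
- have [?|?] := leP ds dp.
    by apply: Lp => [C mC ? ? ? ?|||]; [exact: minH|lra|lra|lra].
  by apply: Ls; lra.
- have [?|?] := leP ds dq.
    by apply: Lq => [C mC ? ? ? ?|||]; [exact: minH|lra|lra|lra].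
  by apply: Ls; lra.
- have [?|?] := leP dr dp.
    by apply: Lp => [C mC ? ? ? ?|||]; [exact: minH|lra|lra|lra].
  by apply: Lr => [C mC ? ? ? ?|||]; [exact: minH|lra|lra|lra].
- have [?|?] := leP dr dq.
    by apply: Lq => [C mC ? ? ? ?|||]; [exact: minH|lra|lra|lra].
  by apply: Lr => [C mC ? ? ? ?|||]; [exact: minH|lra|lra|lra].
Qed.

Lemma quadrilateral_normal_form H : convex_quadrilateral H -> normal_form H.
Proof.
move=> [v [-> nv]].
have mH := @mix_closed_hull (range v).
have Hv i : convex_hull (range v) (v i) by apply: sub_gen_smallest; exists i.
have nt i j k l : i != l -> j != l -> k != l -> ~ triangle (v i) (v j) (v k) (v l).
  move=> il jl kl T; apply: (nv l).
  have sub m : m != l -> convex_hull (v @` [set~ l]) (v m).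
    by move=> ml; apply: sub_gen_smallest; exists m => //=; exact/eqP.
  by apply: triangle_sub T; [exact: mix_closed_hull|exact: sub..].
pose o k (H : (k < 4)%N) : 'I_4 := Ordinal H.
apply: (@quadrilateral_normal_form_points _ (v (@o 0%N isT)) (v (@o 1%N isT))
  (v (@o 2%N isT)) (v (@o 3%N isT))) => //.
  move=> C mC C0 C1 C2 C3; apply: smallest_sub; first exact/mix_closedP.
  by move=> _ [[[|[|[|[|//]]]] lt4] _ <-]; rewrite (bool_irrelevance lt4 isT).
by split; apply: nt.
Qed.

End quadrilateral.

(** * Densities *)

Section disks.
Variable R : realType.
Local Notation T := (measurableTypeR R).

(** Such a [d] has Euclidean length at most [m] times the square root of 2, which is below
    [2 * m]. *)
Lemma disk_add (m rho : R) (p d : R * R) : 0 <= m -> 0 <= rho ->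
  `|d.1| <= m -> `|d.2| <= m -> disk rho p -> disk (rho + 2 * m) (p + d).
Proof.
move=> m0 rho0 d1 d2; rewrite /disk/= => pr.
have absle (x : R) : x ^+ 2 <= rho ^+ 2 -> `|x| <= rho.
  by move=> H; rewrite -(@ler_pXn2r _ 2%N) ?nnegrE// -normrX ger0_norm ?sqr_ge0.
have p1 : `|p.1| <= rho by apply: absle; apply: le_trans pr; rewrite lerDl sqr_ge0.
have p2 : `|p.2| <= rho by apply: absle; apply: le_trans pr; rewrite lerDr sqr_ge0.
have pd (x y : R) : `|x| <= rho -> `|y| <= m -> (x + y) ^+ 2 <= x ^+ 2 + 2 * rho * m + m ^+ 2.
  move=> x1 y1; have xy : x * y <= rho * m.
    by apply: le_trans (ler_norm _) _; rewrite normrM ler_pM.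
  have yy : y ^+ 2 <= m ^+ 2.
    by rewrite -(ger0_norm (sqr_ge0 y)) normrX lerXn2r ?nnegrE.
  nra.
have := pd p.1 d.1 p1 d1; have := pd p.2 d.2 p2 d2; nra.
Qed.

(** Compare with squares of sides [1 / 2] and 2. The value itself cancels from the densities. *)
Lemma area_disk1 : exists2 a : R, 0 < a & area (disk 1 : set (T * T)) = a%:E.
Proof.
have mr (a b c d : R) : measurable (rect ((a, b), (c, d)) : set (T * T)).
  exact: measurable_rect.
have up : (area (disk (1 : R)) <= 4%:E)%E.
  apply: le_trans (area_le (measurable_disk 1) (mr (-1) 1 (-1) 1) _) _.
    move=> [x y]; rewrite /disk /rect/= !in_itv/= => H.
    by split; apply/andP; split; nra.
  by rewrite area_rect/= ?lee_fin; lra.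
have low : ((1 / 4)%:E <= area (disk (1 : R)))%E.
  pose c : R := 1 / 2.
  have : (area (rect ((0%R, c), (0%R, c))) <= area (disk (1 : R)))%E.
    apply: area_le (mr _ _ _ _) (measurable_disk 1) _.
    move=> [x y]; rewrite /disk /rect/= !in_itv/= => -[]; rewrite /c => /andP[? ?] /andP[? ?].
    nra.
  by apply: le_trans; rewrite area_rect/= ?lee_fin /c; lra.
have fa : area (disk (1 : R)) \is a fin_num.
  by rewrite fin_numE; apply/andP; split; apply/eqP => E; move: up low; rewrite E.
exists (fine (area (disk 1))); last by rewrite fineK.
by rewrite -lte_fin fineK//; apply: lt_le_trans low; rewrite lte_fin; lra.
Qed.

End disks.

(** * Counting the translates of a covering near a disk *)

Section counting.
Variable R : realType.
Local Notation T := (measurableTypeR R).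

Lemma esum_ge_count (E : set (set (R * R))) (s : seq (set (R * R))) (k : R) :
  uniq s -> (forall S, S \in s -> E S /\ area S = k%:E) ->
  (((size s)%:R * k)%:E <= \esum_(S in E) area S)%E.
Proof.
move=> us sE; apply: esum_ge; exists [set` s].
  by split; [exact: finite_seq|move=> S /sE[]].
rewrite -fsbig_seq// (eq_big_seq (fun=> k%:E)); last by move=> S /sE[_ ->].
by rewrite sumEFin big_const_seq count_predT iter_addr_0 mulr_natl.
Qed.

Lemma esum_le_count (E : set (set (R * R))) (k b : R) :
  (forall S, E S -> area S = k%:E) ->
  (forall s, uniq s -> (forall S, S \in s -> E S) -> (size s)%:R * k <= b) ->
  (\esum_(S in E) area S <= b%:E)%E.
Proof.
move=> aE H; apply: ge_ereal_sup => _ [F [/finite_seqP[s0 ->] FE] <-].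
have -> : [set` s0] = [set` undup s0] by apply/seteqP; split=> x /=; rewrite mem_undup.
have sE S : S \in undup s0 -> E S by rewrite mem_undup; exact: FE.
rewrite -fsbig_seq ?undup_uniq// (eq_big_seq (fun=> k%:E)); last first.
  by move=> S /sE /aE.
rewrite sumEFin big_const_seq count_predT iter_addr_0 -mulr_natl lee_fin.
exact: H (undup_uniq _) sE.
Qed.

Variables (A e1 e2 : R * R) (f : R -> R) (kappa : R).
Hypothesis det_neq0 : e1.1 * e2.2 - e1.2 * e2.1 != 0.
Hypothesis profile : concave_profile f.
Hypothesis mf : measurable (region f : set (T * T)).
Hypothesis scaling : area_scaling (affine A e1 e2) kappa.

Let K : set (T * T) := affine A e1 e2 @` region f.

(** Cramer's rule for the linear part alone, because it is applied to translation vectors. *)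
Definition coords (x : R * R) : R * R :=
  let D := e1.1 * e2.2 - e1.2 * e2.1 in
  ((x.1 * e2.2 - x.2 * e2.1) / D, (e1.1 * x.2 - e1.2 * x.1) / D).

Lemma affine_coords (p x : R * R) : affine A e1 e2 (p + coords x) = affine A e1 e2 p + x.
Proof.
have D0 := det_neq0.
rewrite [RHS]surjective_pairing /affine /coords; congr pair => /=;
  by rewrite /GRing.scale/=; field.
Qed.

Lemma coords_affine (p : R * R) : coords (affine A e1 e2 p - A) = p.
Proof.
have D0 := det_neq0.
rewrite [RHS]surjective_pairing /affine /coords; congr pair => /=;
  by rewrite /GRing.scale/=; field.
Qed.

Lemma affine_inj : injective (affine A e1 e2).
Proof. by move=> p q E; rewrite -(coords_affine p) E coords_affine. Qed.

Lemma coords_inj : injective coords.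
Proof.
move=> x y E; apply: (addrI (affine A e1 e2 0)).
by rewrite -!affine_coords E.
Qed.

Lemma translate_affine (x p : R * R) :
  translate K x (affine A e1 e2 p) <-> region f (p - coords x).
Proof.
split=> [[_ [q qf <-]]|pf].
  by rewrite -affine_coords => /affine_inj <-; rewrite addrK.
by exists (affine A e1 e2 (p - coords x)); [exists (p - coords x)|rewrite -affine_coords subrK].
Qed.

Lemma preimage_corner_region : affine A e1 e2 @^-1` K = region f.
Proof.
by apply/seteqP; split=> p; [move=> [q qf /affine_inj <-]|exists p].
Qed.

Lemma measurable_corner_region : measurable K.
Proof.
have D0 := det_neq0.
pose D := e1.1 * e2.2 - e1.2 * e2.1.
pose g := affine (- coords A) (e2.2 / D, - e1.2 / D) (- e2.1 / D, e1.1 / D).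
have gE p : g (affine A e1 e2 p) = p.
  rewrite -[RHS]coords_affine /g /affine /coords; congr pair => /=;
    by rewrite /GRing.scale /D/=; field.
have -> : K = g @^-1` region f.
  apply/seteqP; split=> [_ [p pf <-]|y]; rewrite /preimage/= ?gE// => gy.
  exists (g y) => //.
  rewrite /g /affine /coords [RHS]surjective_pairing; congr pair => /=;
    by rewrite /GRing.scale /D/=; field.
have [k [mg _ _]] : exists k, area_scaling g k.
  apply: area_scaling_affine => /=.
  have -> : e2.2 / D * (e1.1 / D) - - e1.2 / D * (- e2.1 / D) = D^-1.
    by rewrite /D; field.
  by rewrite invr_eq0.
by rewrite -[X in measurable X]setTI; exact: mg.
Qed.

Lemma area_corner_region : exists k, area K = k%:E.
Proof.
have [f_noninc _ _ f1] := profile; have [_ k0 sc] := scaling.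
have := sc _ measurable_corner_region; rewrite preimage_corner_region => E.
have f0 : 0 <= f 0 by apply: le_trans f1 (f_noninc _ _ _ _ _).
have : (area (region f) <= (f 0)%:E)%E.
  apply: le_trans (area_le mf (@measurable_rect _ ((0, 1), (0, f 0))) _) _.
    move=> [u w] [/= u0 u1 w0 wf]; split; rewrite /= in_itv/=; apply/andP; split => //.
    by apply: le_trans wf (f_noninc _ _ _ _ _).
  by rewrite area_rect//= !subr0 mul1r.
rewrite E; have : (0 <= area K)%E by exact: measure_ge0.
case: (area K) => [k _ _|_|//]; first by exists k.
by rewrite gt0_muley ?lte_fin.
Qed.

(** In the affine frame, a point of a translate that meets the unit segment to the right of [p]
    differs from [p] by at most 2 horizontally (segment plus width) and [f 0] vertically. *)
Definition spread : R :=
  2 * (`|e1.1| + `|e1.2|) + f 0 * (`|e2.1| + `|e2.2|).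

Lemma translate_sub_disk (x p q : R * R) : region f (q - coords x) -> p.1 <= q.1 ->
  q.1 <= p.1 + 1 -> q.2 = p.2 -> forall rho, 0 <= rho ->
  disk rho (affine A e1 e2 p) -> translate K x `<=` disk (rho + 2 * spread).
Proof.
move Ez : (coords x) => z; move=> [/= a0 a1 b0 bf] pq1 qp1 q2 rho rho0 dp _ [_ [c [/= c0 c1 d0 df] <-] <-].
have [f_noninc _ _ f1] := profile.
have bf0 : q.2 - z.2 <= f 0 by apply: le_trans bf (f_noninc _ _ _ _ _).
have df0 : c.2 <= f 0 by apply: le_trans df (f_noninc _ _ _ _ _).
have f00 : 0 <= f 0 by lra.
have bound (y y' : R) : `|(c.1 + z.1 - p.1) * y + (c.2 + z.2 - p.2) * y'| <=
    2 * `|y| + f 0 * `|y'|.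
  apply: le_trans (ler_normD _ _) _; rewrite !normrM; apply: lerD; apply: ler_wpM2r => //.
    by rewrite ler_norml; apply/andP; split; lra.
  by rewrite ler_norml; apply/andP; split; lra.
have n11 := normr_ge0 e1.1; have n12 := normr_ge0 e1.2.
have n21 := normr_ge0 e2.1; have n22 := normr_ge0 e2.2.
have m0 : 0 <= spread by rewrite /spread addr_ge0// mulr_ge0// addr_ge0.
rewrite -affine_coords Ez.
have -> : affine A e1 e2 (c + z) = affine A e1 e2 p +
  ((c.1 + z.1 - p.1) * e1.1 + (c.2 + z.2 - p.2) * e2.1,
   (c.1 + z.1 - p.1) * e1.2 + (c.2 + z.2 - p.2) * e2.2).
  by rewrite /affine; congr pair => /=; rewrite /GRing.scale/=; ring.
apply: disk_add => //=.
  by apply: le_trans (bound _ _) _; rewrite /spread; nra.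
by apply: le_trans (bound _ _) _; rewrite /spread; nra.
Qed.

(* No local finiteness of [X] is needed: if infinitely many translates lie in
   the disk, [n] can be taken arbitrarily large. *)
Lemma covering_count (X : set (R * R)) (k a rho : R) :
  area K = k%:E -> area (disk 1 : set (T * T)) = a%:E -> 0 < sup_Lshape f ->
  0 < rho ->
  \bigcup_(x in X) translate K x = setT ->
  exists2 n : nat,
    ((n%:R * k)%:E <= \esum_(S in [set S | translates K X S /\
        S `<=` disk (rho + 2 * spread)]) area S)%E &
    kappa * (rho ^+ 2 * a) <= n%:R * sup_Lshape f.
Proof.
move=> Kk a1 S0 rho_gt0 cov; have rho0 := ltW rho_gt0; set E := [set S | _].
have [f_noninc f_concave f_closed f1] := profile.
have aE S : E S -> area S = k%:E.
  by move=> [[x _ <-] _]; rewrite area_translate//; exact: measurable_corner_region.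
have [mg kap0 sc] := scaling.
have mD : measurable (affine A e1 e2 @^-1` disk rho : set (T * T)).
  by rewrite -[X in measurable X]setTI; apply: mg => //; exact: measurable_disk.
have [Efin|Einf] := pselect (finite_set E); last first.
  pose b := kappa * (rho ^+ 2 * a).
  have [s sE sn] := infinite_set_fset (Num.bound `|b / sup_Lshape f|) Einf.
  exists (size (finmap.enum_fset s)).
    apply: esum_ge_count; first exact: finmap.fset_uniq.
    by move=> S /sE ES; split=> //; exact: aE.
  rewrite -ler_pdivrMr// -/b; apply: le_trans (ler_norm _) _.
  by apply: le_trans (ltW (archi_boundP _)) _; rewrite ?ler_nat.
have /finite_seqP[s0 Es] := Efin.
pose s := undup s0.
have sE S : S \in s <-> E S by rewrite mem_undup Es.
have us : uniq s by exact: undup_uniq.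
(* The translates form a set of sets, so a translation vector is chosen for each member. *)
pose rep S := xget 0 [set x | X x /\ translate K x = S].
have repP S : S \in s -> translate K (rep S) = S.
  move=> /sE[[x Xx xS] _]; rewrite /rep; case: xgetP => [y _ []//|/(_ x)[]].
  by split.
exists (size s); first by apply: esum_ge_count => // S /sE ES; split=> //; exact: aE.
rewrite -(size_map (coords \o rep)).
have areaD : area (affine A e1 e2 @^-1` disk rho) = (kappa * (rho ^+ 2 * a))%:E.
  by rewrite (sc _ (measurable_disk rho)) (area_disk rho_gt0) a1 !EFinM.
rewrite -lee_fin -areaD.
apply: (area_covered f_noninc f1 f_concave f_closed) => //.
  rewrite map_inj_in_uniq// => S S' Ss S's /coords_inj E'.
  by rewrite -(repP _ Ss) -(repP _ S's) E'.
move=> p dp t pt tp.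
have : [set: R * R] (affine A e1 e2 (t, p.2)) by [].
rewrite -cov => -[x Xx xp].
have Ss : translate K x \in s.
  apply/sE; split; first by exists x.
  by apply: (@translate_sub_disk x p (t, p.2)) => //; apply/translate_affine.
exists (coords (rep (translate K x))); first exact: (map_f (coords \o rep)).
move: xp; rewrite -{1}(repP _ Ss) translate_affine.
move: (coords (rep _)) => z [/= z0 z1 w0 w1]; split.
- by apply/andP; split; lra.
- lra.
- by rewrite /roof; lra.
Qed.

End counting.

Lemma int_norm_lt1_eq0 (R : realType) (k : int) : `|k%:~R : R| < 1 -> k = 0.
Proof. by rewrite -intr_norm ltrz1 -[1]add0r ltzD1 normr_le0 => /eqP. Qed.

(** * The lattice covering given by an inscribed L-shape *)

Section Lshape_lattice.
Variable R : realType.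
Local Notation T := (measurableTypeR R).
Variables (A e1 e2 : R * R) (f : R -> R) (kappa : R).
Hypothesis det_neq0 : e1.1 * e2.2 - e1.2 * e2.1 != 0.
Hypothesis profile : concave_profile f.
Hypothesis scaling : area_scaling (affine A e1 e2) kappa.
Variable t : R * R.
Hypotheses (t1_gt0 : 0 < t.1) (t12 : t.1 <= t.2) (t2_le1 : t.2 <= 1)
  (ft1_gt0 : 0 < f t.1).

Let K : set (T * T) := affine A e1 e2 @` region f.
Let cell : set (T * T) := Lcell t.1 t.2 (f t.1) (f t.2).
Let vec := Lvec t.1 t.2 (f t.1) (f t.2).
Let u := affine 0 e1 e2 (t.1, f t.2).
Let v := affine 0 e1 e2 (t.2, f t.2 - f t.1).

Definition Lshape_lattice : set (R * R) :=
  [set u *~ m + v *~ n | m in [set: int] & n in [set: int]].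

Let ft2_ge0 : 0 <= f t.2.
Proof.
have [f_noninc _ _ f1] := profile; have T1 := t1_gt0; have T12 := t12.
by apply: (profile_ge0 f_noninc f1) => //; lra.
Qed.

Let ft21 : f t.2 <= f t.1.
Proof. by have [f_noninc _ _ _] := profile; apply: f_noninc => //; exact: ltW. Qed.

Lemma Larea_gt0 : 0 < Larea f t.
Proof. by rewrite /Larea ltr_pwDl ?mulr_gt0// mulr_ge0// subr_ge0. Qed.

Lemma measurable_Lcell : measurable cell.
Proof. by apply: measurableU; apply: measurableX. Qed.

Lemma area_Lcell : area cell = (Larea f t)%:E.
Proof.
have itv (a b : R) : a <= b -> lebesgue_measure `[a, b[%classic = (b - a)%:E.
  move=> ab; rewrite lebesgue_measure_itv/= lte_fin; case: ltP => // ba.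
  by congr EFin; lra.
have box (a b c d : R) : a <= b -> c <= d ->
    area (`[a, b[ `*` `[c, d[) = ((b - a) * (d - c))%:E.
  by move=> ab cd; rewrite /area product_measure1E//= (itv _ _ ab) (itv _ _ cd).
have Lbox : Larea f t = (t.1 - 0) * (f t.1 - 0) + (t.2 - t.1) * (f t.2 - 0).
  by rewrite !subr0.
rewrite Lbox EFinD -(box 0 t.1 0 (f t.1)) ?ltW// -(box t.1 t.2 0 (f t.2))//.
apply: area_setU; [exact: measurableX|exact: measurableX|].
apply/seteqP; split => // p [[/=]]; rewrite !in_itv/= => /andP[_ a] _ [/andP[b _] _].
by move: a; rewrite ltNge b.
Qed.

Lemma Lcell_sub_region : cell `<=` region f.
Proof.
have [f_noninc _ _ _] := profile.
move=> p /(LcellP t1_gt0 t12 ft1_gt0 ft2_ge0 ft21)[p1 p2 H]; have T2 := t2_le1; have T12 := t12.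
have [pt|pt] : (p.1 <= t.1 /\ p.2 < f t.1) \/ (p.1 <= t.2 /\ p.2 < f t.2).
  by case: H => -[? ?]; [left|right]; split=> //; exact: ltW.
- split=> //; first lra.
  by apply: ltW; apply: lt_le_trans pt.2 (f_noninc _ _ _ _ _); lra.
- split=> //; first lra.
  by apply: ltW; apply: lt_le_trans pt.2 (f_noninc _ _ _ _ _); lra.
Qed.

Lemma lattice_vecE m n : u *~ m + v *~ n = affine 0 e1 e2 (vec m n).
Proof.
rewrite -(scaler_int m u) -(scaler_int n v) /u /v /vec /Lvec /affine !add0r; congr pair => /=;
  by rewrite /GRing.scale/=; ring.
Qed.

Lemma coords_vec m n : coords e1 e2 (u *~ m + v *~ n) = vec m n.
Proof. by rewrite lattice_vecE -[affine _ _ _ _]subr0 coords_affine. Qed.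

Lemma lattice_Lshape_lattice : lattice Lshape_lattice.
Proof.
exists u, v; split=> // a b E.
have ab : (a * t.1 + b * t.2, a * f t.2 + b * (f t.2 - f t.1)) = 0.
  rewrite -(@coords_affine _ 0 e1 e2 det_neq0 (_, _)) subr0.
  rewrite -[RHS](@coords_affine _ 0 e1 e2 det_neq0 0) subr0; congr coords.
  have -> : affine 0 e1 e2 0 = 0 by rewrite /affine/= !scale0r !addr0.
  rewrite -[RHS]E /u /v /affine !add0r; congr pair => /=; rewrite /GRing.scale/=; ring.
have [E1 E2] : a * t.1 + b * t.2 = 0 /\ a * f t.2 + b * (f t.2 - f t.1) = 0.
  by case: ab.
have L0 : Larea f t != 0 by rewrite gt_eqF// Larea_gt0.
have a0 : a = 0.
  apply: (mulIf L0); rewrite mul0r.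
  transitivity ((a * f t.2 + b * (f t.2 - f t.1)) * t.2
    - (a * t.1 + b * t.2) * (f t.2 - f t.1)); first by rewrite /Larea; ring.
  by rewrite E1 E2 !mul0r subr0.
split=> //; have t20 : t.2 != 0 by rewrite gt_eqF// (lt_le_trans t1_gt0 t12).
by apply: (mulIf t20); move: E1; rewrite a0 !mul0r add0r.
Qed.

(** By Cramer's rule, each integer coefficient of a difference of lattice points, times [D], is a
    combination of the coordinates of that difference. Within distance [e] it is smaller than [D] in
    absolute value, so the coefficient vanishes. *)
Lemma discrete_Lshape_lattice : discrete_set Lshape_lattice.
Proof.
have D0 := det_neq0.
have cE (x y : R * R) : coords e1 e2 (y - x) = coords e1 e2 y - coords e1 e2 x.
  by rewrite /coords; congr pair => /=; field.
have L0 : Larea f t != 0 by rewrite gt_eqF// Larea_gt0.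
pose D := u.1 * v.2 - u.2 * v.1.
have Dn0 : D != 0.
  have -> : D = - (e1.1 * e2.2 - e1.2 * e2.1) * Larea f t.
    by rewrite /D /u /v /affine /Larea /= /GRing.scale/=; ring.
  by rewrite mulf_neq0 ?oppr_eq0.
pose M := `|u.1| + `|u.2| + `|v.1| + `|v.2| + 1.
have M0 : 0 < M by rewrite /M ltr_wpDl// !addr_ge0.
have D_gt0 : 0 < `|D| by rewrite normr_gt0.
pose e := `|D| / M.
have e0 : 0 < e by exact: divr_gt0.
move=> x [m _ [n _ Ex]]; split; first by rewrite inE -Ex; exists m => //; exists n.
exists (ball x e); first exact: nbhsx_ballx.
apply/seteqP; split=> [y [[b1 b2] [m' _ [n' _ Ey]]]|y ->]; last first.
  by split; [exact: ballxx|rewrite -Ex; exists m => //; exists n].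
have [m0 n0] : m' - m = 0 /\ n' - n = 0.
  have {}Ey : y - x = (m' - m)%:~R *: u + (n' - n)%:~R *: v.
    by rewrite -Ey -Ex !scaler_int !mulrzBr; ring.
  have small (k : int) (a b c d : R) : k%:~R * D = a * b - c * d ->
      `|a| < e -> `|c| < e -> `|b| + `|d| <= M - 1 -> k = 0.
    move=> kD ae ce bd.
    have : `|k%:~R * D| < `|D|.
      rewrite kD; apply: le_lt_trans (ler_normB _ _) _; rewrite !normrM.
      have -> : `|D| = e * M by rewrite /e divfK// gt_eqF.
      by have := normr_ge0 b; have := normr_ge0 d; nra.
    rewrite normrM -ltr_pdivlMr// divff ?gt_eqF//.
    exact: int_norm_lt1_eq0.
  have d1 : `|(y - x).1| < e by rewrite distrC; exact: b1.
  have d2 : `|(y - x).2| < e by rewrite distrC; exact: b2.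
  have nu1 := normr_ge0 u.1; have nu2 := normr_ge0 u.2.
  have nv1 := normr_ge0 v.1; have nv2 := normr_ge0 v.2.
  split.
    apply: (small _ (y - x).1 v.2 (y - x).2 v.1) => //; last by rewrite /M; lra.
    by rewrite Ey /D/=; rewrite /GRing.scale/=; ring.
  apply: (small _ (y - x).2 u.1 (y - x).1 u.2) => //; last by rewrite /M; lra.
  by rewrite Ey /D/=; rewrite /GRing.scale/=; ring.
by rewrite /= -Ey -Ex; congr (_ *~ _ + _ *~ _); apply/eqP; rewrite -subr_eq0 ?m0 ?n0.
Qed.

Lemma translative_covering_Lshape_lattice : translative_covering K Lshape_lattice.
Proof.
split; first exact: discrete_Lshape_lattice.
rewrite -subTset => y _.
pose p := coords e1 e2 (y - A).
have yE : affine A e1 e2 p = y.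
  have := @affine_coords _ A e1 e2 det_neq0 0 (y - A).
  by rewrite add0r => ->; rewrite /affine/= !scale0r !addr0 addrC subrK.
have [m [n mn]] := Lcell_cover t1_gt0 t12 ft1_gt0 ft2_ge0 ft21 p.
exists (u *~ m + v *~ n); first by exists m => //; exists n.
rewrite -yE; apply/translate_affine => //.
by rewrite coords_vec; exact: Lcell_sub_region.
Qed.

(** Each translate contains its own L-shaped tile; the tiles are disjoint and lie, in affine
    coordinates, in the preimage of the disk. *)
Lemma packing_count (s : seq (set (R * R))) (r a : R) :
  area (disk 1 : set (T * T)) = a%:E -> 0 < r -> uniq s ->
  (forall S, S \in s -> translates K Lshape_lattice S /\ S `<=` disk r) ->
  (size s)%:R * Larea f t <= kappa * (r ^+ 2 * a).
Proof.
move=> a1 r0 us sE; have [mg _ sc] := scaling.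
have coordK S : S \in s -> exists mn : int * int,
    S = translate K (u *~ mn.1 + v *~ mn.2).
  by move=> /sE[[_ [m _ [n _ <-]] <-] _]; exists (m, n).
pose idx S := xget (0, 0) [set mn : int * int | S = translate K (u *~ mn.1 + v *~ mn.2)].
have idxP S : S \in s -> S = translate K (u *~ (idx S).1 + v *~ (idx S).2).
  by move=> /coordK[mn E]; rewrite /idx; case: xgetP => [mn' _ //|/(_ mn)].
pose tile S := translate cell (vec (idx S).1 (idx S).2).
have mtile S : measurable (tile S).
  rewrite /tile translateE; have [mt _ _] := area_scaling_translation (vec (idx S).1 (idx S).2).
  by rewrite -[X in measurable X]setTI; apply: mt => //; exact: measurable_Lcell.
have tile_sub S : S \in s -> tile S `<=` affine A e1 e2 @^-1` disk r.
  move=> Ss p; have [_ Sr] := sE _ Ss.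
  rewrite /tile translateE => cp; apply: Sr; rewrite (idxP _ Ss).
  apply/translate_affine => //; rewrite coords_vec; exact: Lcell_sub_region.
have tiles_area s' : uniq s' -> {subset s' <= s} ->
    measurable [set p | exists2 S, S \in s' & tile S p] /\
    area [set p | exists2 S, S \in s' & tile S p] = ((size s')%:R * Larea f t)%:E.
  elim: s' => [|S s' IH] /=.
    move=> _ _; have -> : [set p | exists2 S, S \in [::] & tile S p] = set0.
      by apply/seteqP; split => // p [].
    by rewrite mul0r /area measure0.
  move=> /andP[Ss' us'] sub.
  have [] := IH us'; first by move=> S' S's'; apply: sub; rewrite inE S's' orbT.
  set U := [set p | _] => mU aU.
  have -> : [set p | exists2 S0, S0 \in S :: s' & tile S0 p] = tile S `|` U.
    apply/seteqP; split => p.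
      by case=> S0; rewrite inE => /orP[/eqP ->|H] ?; [left|right; exists S0].
    case=> [?|[S0 H ?]]; first by exists S; rewrite ?mem_head.
    by exists S0; rewrite // inE H orbT.
  split; first exact: measurableU.
  have disj : tile S `&` U = set0.
    apply/seteqP; split => // p [tS [S0 S0s' tS0]].
    have [E1 E2] : (idx S).1 = (idx S0).1 /\ (idx S).2 = (idx S0).2.
      move: tS tS0; rewrite /tile !translateE.
      exact: (Lcell_disjoint t1_gt0 t12 ft1_gt0 ft2_ge0 ft21).
    move: Ss'; rewrite (idxP S) ?E1 ?E2 -?(idxP S0) ?S0s'//.
      by apply: sub; rewrite inE S0s' orbT.
    by apply: sub; rewrite mem_head.
  transitivity (area (tile S) + area U)%E; first exact: area_setU (mtile S) mU disj.
  rewrite aU /tile area_translate ?area_Lcell; last exact: measurable_Lcell.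
  by rewrite -EFinD -natr1 mulrDl mul1r addrC.
have [mU aU] := tiles_area s us (fun _ => id).
rewrite -lee_fin -aU EFinM EFinM -a1 -(area_disk r0) -(sc _ (measurable_disk r)).
apply: area_le => //.
  by rewrite -[X in measurable X]setTI; apply: mg => //; exact: measurable_disk.
by move=> p [S Ss]; exact: tile_sub.
Qed.

End Lshape_lattice.

(** * Passage to the limit and equality of the densities *)

Section densities.
Variable R : realType.
Local Notation T := (measurableTypeR R).

Lemma lower_density_ge (F : set (set (R * R))) (b : R) :
  (forall e : R, 0 < e -> exists M : R, forall r, M < r ->
    ((b - e)%:E <= inner_density F (disk r))%E) ->
  (b%:E <= lower_density F)%E.
Proof.
move=> H; rewrite /lower_density limf_einfE; apply/lee_subgt0Pr => e e0.
have [M HM] := H e e0.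
have le_inf : ((b - e)%:E <= ereal_inf
    [set inner_density F (disk r) | r in [set r | (M < r)%R]])%E.
  by apply: le_ereal_inf_tmp => _ [r Mr <-]; exact: HM.
apply: (le_trans le_inf); apply: ereal_sup_ubound.
by exists [set r | (M < r)%R] => //; exists M; split => //; exact: num_real.
Qed.

Lemma lower_density_le (F : set (set (R * R))) (b : \bar R) :
  (forall r : R, 0 < r -> (inner_density F (disk r) <= b)%E) ->
  (lower_density F <= b)%E.
Proof.
move=> H; rewrite /lower_density limf_einfE.
apply: ge_ereal_sup => _ [V [M [_ MV]] <-].
have m0 : 0 < Num.max M 0 + 1 by rewrite ltr_wpDl// le_max lexx orbT.
apply: le_trans (H _ m0); apply: ereal_inf_lbound.
exists (Num.max M 0 + 1) => //; apply: MV.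
by rewrite ltr_pwDr// le_max lexx.
Qed.

Lemma inner_densityE (F : set (set (R * R))) (r a : R) : 0 < a -> 0 < r ->
  area (disk 1 : set (T * T)) = a%:E ->
  (inner_density F (disk r) =
    (\esum_(S in [set S | F S /\ S `<=` disk r]) area S) * ((r ^+ 2 * a)^-1)%:E)%E.
Proof.
move=> a0 r0 a1; rewrite /inner_density (area_disk r0) a1 -EFinM inver.
by rewrite gt_eqF// mulr_gt0// exprn_gt0.
Qed.

Variables (A e1 e2 : R * R) (f : R -> R) (kappa k a : R).
Hypothesis det_neq0 : e1.1 * e2.2 - e1.2 * e2.1 != 0.
Hypothesis profile : concave_profile f.
Hypothesis mf : measurable (region f : set (T * T)).
Hypothesis scaling : area_scaling (affine A e1 e2) kappa.
Let K : set (T * T) := affine A e1 e2 @` region f.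
Hypothesis area_K : area K = k%:E.
Hypotheses (a_gt0 : 0 < a) (area_disk1 : area (disk 1 : set (T * T)) = a%:E).
Hypothesis sup_gt0 : 0 < sup_Lshape f.

Let k_ge0 : 0 <= k.
Proof. by rewrite -lee_fin -area_K; exact: measure_ge0. Qed.

(** [k * kappa] is the area of [region f], so the bound is the ratio of that area to the largest
    L-shape. *)
Lemma translative_density_ge (X : set (R * R)) :
  \bigcup_(x in X) translate K x = setT ->
  ((k * kappa / sup_Lshape f)%:E <= lower_density (translates K X))%E.
Proof.
move=> cov; apply: lower_density_ge => e e0.
have [_ kap0 _] := scaling; have a0 := a_gt0; have k0 := k_ge0.
have S0 := sup_gt0; set S2 := sup_Lshape f in S0 *.
set B := k * kappa / S2.
have B0 : 0 <= B by rewrite divr_ge0 ?(ltW S0)// mulr_ge0 ?(ltW kap0).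
have [f_noninc _ _ f1] := profile.
have f00 : 0 <= f 0 by apply: le_trans f1 (f_noninc _ _ _ _ _).
pose m := 2 * spread e1 e2 f.
have m0 : 0 <= m by rewrite /m /spread mulr_ge0// addr_ge0// mulr_ge0// addr_ge0.
have Be0 : 0 <= 2 * B * m / e by apply: divr_ge0 (ltW e0); apply: mulr_ge0 m0; apply: mulr_ge0.
(* Beyond this radius [2 * B * m <= e * r], hence [B * (r - m) ^+ 2] is at least
   [(B - e) * r ^+ 2]. *)
exists (m + 2 * B * m / e) => r Mr.
have r0 : 0 < r by lra.
have rho0 : 0 < r - m by lra.
have er : 2 * B * m <= e * r.
  by rewrite (mulrC e) -ler_pdivrMr//; lra.
rewrite (inner_densityE _ a0 r0 area_disk1) lee_pdivlMr; last first.
  by rewrite mulr_gt0// exprn_gt0.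
have [n nk nS] := covering_count det_neq0 profile mf scaling area_K area_disk1 S0 rho0 cov.
move: nk; rewrite -/m subrK; apply: le_trans.
rewrite -EFinM lee_fin.
have BS : k * kappa = B * S2 by rewrite /B divfK// gt_eqF.
have nk : B * (r - m) ^+ 2 * a <= n%:R * k.
  have : k * (kappa * ((r - m) ^+ 2 * a)) <= k * (n%:R * S2) by exact: ler_wpM2l.
  have -> : k * (kappa * ((r - m) ^+ 2 * a)) = (B * (r - m) ^+ 2 * a) * S2.
    by rewrite mulrA BS; ring.
  have -> : k * (n%:R * S2) = n%:R * k * S2 by ring.
  by rewrite ler_pM2r.
apply: le_trans nk; rewrite mulrA ler_pM2r//.
have : 2 * B * m * r <= e * r * r by rewrite ler_pM2r.
have : 0 <= B * m ^+ 2 by rewrite mulr_ge0// sqr_ge0.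
by rewrite !expr2; nra.
Qed.

Lemma lattice_density_le (t : R * R) : Lshapes t -> 0 < Larea f t ->
  (lattice_covering_density K <= (k * kappa / Larea f t)%:E)%E.
Proof.
(* The tiling needs a first column of positive width; an L-shape with [t.1 = 0] is a rectangle,
   described as well by [(t.2, t.2)]. *)
wlog t1_gt0 : t / 0 < t.1.
  move=> H Lt La; have [|t1_le0] := ltP 0 t.1; first by move=> t1; exact: H.
  move: Lt La; case: t t1_le0 => s t /= s0 [/= s0' st t1]; have -> : s = 0 by lra.
  rewrite {1}/Larea/= mul0r add0r subr0 => La.
  have E : Larea f (0, t) = Larea f (t, t).
    by rewrite /Larea/= mul0r add0r subr0 subrr mul0r addr0.
  have t_gt0 : 0 < t.
    by rewrite lt_neqAle (le_trans s0' st) andbT; apply: contraTneq La => <-; rewrite mul0r ltxx.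
  by rewrite E; apply: H => //=; rewrite -?E /Larea/= ?mul0r ?add0r ?subr0//; split=> //=; lra.
move=> [t10 t12 t21] La.
have [f_noninc _ _ f1] := profile.
have ft_gt0 : 0 < f t.1.
  have ft : f t.2 <= f t.1 by exact: f_noninc.
  rewrite ltNge; apply/negP => ft1; move: La; rewrite /Larea; nra.
apply: (@le_trans _ _ (lower_density (translates K (Lshape_lattice e1 e2 f t)))).
  apply: ereal_inf_lbound; exists (Lshape_lattice e1 e2 f t) => //; split.
    exact: translative_covering_Lshape_lattice.
  exact: lattice_Lshape_lattice.
apply: lower_density_le => r r0.
have ra : 0 < r ^+ 2 * a by rewrite mulr_gt0// exprn_gt0.
rewrite (inner_densityE _ a_gt0 r0 area_disk1) lee_pdivrMr// -EFinM.
apply: esum_le_count => [S [[x _ <-] _]|s us sE].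
  by rewrite area_translate; [exact: area_K|exact: measurable_corner_region].
have := packing_count det_neq0 profile scaling t1_gt0 t12 t21 ft_gt0 area_disk1 r0 us sE.
move=> H; rewrite mulrAC ler_pdivlMr//.
have -> : (size s)%:R * k * Larea f t = k * ((size s)%:R * Larea f t) by ring.
by rewrite -mulrA; exact: ler_wpM2l.
Qed.

Lemma lattice_density_le_sup :
  (lattice_covering_density K <= (k * kappa / sup_Lshape f)%:E)%E.
Proof.
set B := k * kappa / sup_Lshape f; apply/lee_addgt0Pr => e e0.
have [_ kap0 _] := scaling; have S0 := sup_gt0.
have B0 : 0 <= B by rewrite divr_ge0 ?(ltW S0)// mulr_ge0 ?(ltW kap0).
have BS : k * kappa = B * sup_Lshape f by rewrite /B divfK// gt_eqF.
have Be : 0 < B + e by lra.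
(* The supremum may not be attained; an L-shape of area above this value gives a density of at most
   [B + e]. *)
have lt_sup : B * sup_Lshape f / (B + e) < sup_Lshape f.
  by rewrite ltr_pdivrMr//; nra.
have [|_ [t Lt <-] Bt] := sup_gt _ lt_sup.
  by exists (Larea f (0, 0)); exists (0, 0) => //; split=> /=; lra.
have La : 0 < Larea f t.
  by apply: le_lt_trans Bt; rewrite divr_ge0 ?(ltW Be)// mulr_ge0 ?(ltW S0).
apply: le_trans (lattice_density_le Lt La) _.
rewrite -EFinD lee_fin BS ler_pdivrMr//.
by move: Bt; rewrite ltr_pdivrMr// => /ltW; rewrite (mulrC (Larea f t)).
Qed.

Lemma covering_densities_eq :
  translative_covering_density K = lattice_covering_density K.
Proof.
apply/eqP; rewrite eq_le; apply/andP; split.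
  apply: le_ereal_inf => _ [X [cov _] <-]; by exists X.
apply: le_trans lattice_density_le_sup _.
by apply: le_ereal_inf_tmp => _ [X [_ cov] <-]; exact: translative_density_ge.
Qed.

End densities.

Theorem theorem4p2 (R : realType) (K : set (R * R)) :
  convex_quadrilateral K ->
  translative_covering_density K = lattice_covering_density K.
Proof.
move=> /quadrilateral_normal_form[A [e1 [e2 [f [d0 pf mf [u [u0 u1 fu]] ->]]]]].
have [kappa sc] := area_scaling_affine A d0.
have [k Kk] := area_corner_region d0 pf mf sc.
have [a a0 a1] := area_disk1 R.
apply: (covering_densities_eq d0 pf mf sc Kk a0 a1).
have [f_noninc _ _ f1] := pf.
(* The pair [(u, u)] describes a rectangle of positive area, which makes [sup_Lshape f] positive. *)
have := @Larea_le_sup _ f f_noninc f1 (u, u) (And3 (ltW u0) (lexx u) u1).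
by apply: lt_le_trans; rewrite /Larea/= subrr mul0r addr0 mulr_gt0.
Qed.
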